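(* Let $C\subseteq\mathbb{R}^d$ be nonempty, closed and convex, let $z\in\mathbb{R}^d$, $B\in\mathbb{R}^{n\times d}$, let $\varphi\in\mathrm{SPF}(\mathbb{R}^n)$ be convex, and let $\lambda,\alpha>0$. Consider the problem $$(\mathcal P)\qquad \operatorname{argmin}\left\{\frac{1}{2\lambda}\|x-z\|^2+\varphi_\alpha(Bx)\;:\;x\in C\right\}.$$ Let $\tau,\sigma>0$, let $x^{(0)}\in\mathbb{R}^d$, $y^{(0)}\in\mathbb{R}^n$ be arbitrary, and let the sequences be generated for $k=0,1,2,\dots$ by $$\tilde x^{(k+1)}=\mathrm{proj}_C\!\left(x^{(k)}-\frac{\tau}{\lambda}(x^{(k)}-z)+\tau B^\top\left(\mathrm{prox}_{\alpha^{-1}\varphi^*}(\alpha^{-1}Bx^{(k)})-y^{(k)}\right)\right),$$ $$\tilde y^{(k+1)}=\mathrm{prox}_{\sigma\varphi^*}\!\left(y^{(k)}+\sigma B(2\tilde x^{(k+1)}-x^{(k)})\right),$$ $$x^{(k+1)}=\rho\,\tilde x^{(k+1)}+(1-\rho)x^{(k)},\qquad y^{(k+1)}=\rho\,\tilde y^{(k+1)}+(1-\rho)y^{(k)}.$$ Suppose that $\lambda<\frac{\alpha}{\|B\|^2}$ and that (i) $\frac1\tau-\sigma\|B\|^2>\frac{1}{2\lambda}$; (ii) $\rho\in(0,1]$. Then the sequence $(x^{(k)})_{k\in\mathbb{N}}$ converges to a solution of problem $(\mathcal P)$.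
   Context: $\|\cdot\|$ is the Euclidean norm on vectors and $\|B\|$ is the spectral norm of the matrix $B$ (when $B=0$, read $\alpha/\|B\|^2$ as $+\infty$). $\mathrm{proj}_C$ is the Euclidean projection onto $C$. $\varphi^*$ is the Fenchel conjugate of $\varphi$. $\Gamma(\mathbb{R}^n)$ is the set of proper lower semicontinuous functions $\mathbb{R}^n\to\mathbb{R}\cup\{+\infty\}$. The Fréchet subdifferential of $p$ at $z$ is $\partial p(z)=\{t:\liminf_{u\to z}\frac{p(u)-p(z)-\langle t,u-z\rangle}{\|u-z\|}\ge 0\}$; for convex $p$ it is the usual convex subdifferential. A function $\varphi\in\Gamma(\mathbb{R}^n)$ is sparsity promoting, written $\varphi\in\mathrm{SPF}(\mathbb{R}^n)$, if (a) $\varphi$ achieves its global minimum, equal to zero, at the origin, and (b) $\partial\varphi(0)$ contains a nonzero element. For $p\in\Gamma(\mathbb{R}^n)$ and $\beta>0$, $\mathrm{prox}_{\beta p}(z)=\operatorname{argmin}\{p(w)+\frac{1}{2\beta}\|w-z\|^2: w\in\mathbb{R}^n\}$ (single-valued when $p$ is convex) and the Moreau envelope is $\mathrm{env}_\beta p(z)=\min\{p(w)+\frac{1}{2\beta}\|w-z\|^2: w\in\mathbb{R}^n\}$. For convex $\varphi\in\mathrm{SPF}(\mathbb{R}^n)$ and $\alpha>0$, $\varphi_\alpha:=\varphi-\mathrm{env}_\alpha\varphi$.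
   Formalization: The formal theorem additionally assumes that problem (P) is feasible, i.e. some u in C has finite objective (φ(Bu) < +∞); without this (P) has no solution and x^(k) may diverge, e.g. C={(a,b): a>0, ab≥1}, B=[0 1], z=0, φ the indicator of {0}. *)

(* Defs.v *)
From HB Require Import structures.
From mathcomp Require Export all_boot all_order all_algebra.
From mathcomp Require Export all_classical all_reals all_analysis.

Set Implicit Arguments.
Unset Strict Implicit.
Unset Printing Implicit Defensive.

Import Order.TTheory GRing.Theory Num.Theory.
Import numFieldNormedType.Exports.

Local Open Scope classical_set_scope.
Local Open Scope ring_scope.

Definition dotv (R : realType) (n : nat) (u v : 'cV[R]_n) : R :=
  \sum_(i < n) u i 0 * v i 0.

(* The library norm `|u| on matrices is the sup norm, hence this one. Both
   induce the same topology, so closed sets, limits, neighbourhoods and lower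
   semicontinuity are those of the library. *)
Definition enorm (R : realType) (n : nat) (u : 'cV[R]_n) : R :=
  Num.sqrt (dotv u u).

Definition spectral_norm (R : realType) (n d : nat) (B : 'M[R]_(n, d)) : R :=
  sup [set enorm (B *m x) | x in [set x : 'cV[R]_d | enorm x <= 1]].

Definition argmin (R : realType) (T : Type) (S : set T) (f : T -> \bar R) :
    set T :=
  [set x | S x /\ forall u, S u -> (f x <= f u)%E].

Definition Gamma (R : realType) (n : nat) (p : 'cV[R]_n -> \bar R) : Prop :=
  [/\ forall u, p u != -oo%E, exists u, (p u < +oo)%E & lower_semicontinuous p].

Definition econvex (R : realType) (n : nat) (p : 'cV[R]_n -> \bar R) : Prop :=
  forall (u v : 'cV[R]_n) (t : R), 0 <= t <= 1 ->
    (p (t *: u + (1 - t) *: v)%R <= t%:E * p u + (1 - t)%:E * p v)%E.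

(* Frechet subdifferential; empty where p is infinite. *)
Definition fsubdiff (R : realType) (n : nat) (p : 'cV[R]_n -> \bar R)
    (z : 'cV[R]_n) : set 'cV[R]_n :=
  [set t | p z \is a fin_num /\
    (0 <= limf_einf (fun u : 'cV[R]_n =>
            (p u - p z - (dotv t (u - z)%R)%:E) * ((enorm (u - z)%R)^-1)%:E)
          z^')%E].

Definition SPF (R : realType) (n : nat) (p : 'cV[R]_n -> \bar R) : Prop :=
  [/\ Gamma p, p 0 = 0%E /\ (forall u, (0 <= p u)%E)
    & exists2 t, t != 0 & fsubdiff p 0 t].

Definition fconj (R : realType) (n : nat) (p : 'cV[R]_n -> \bar R)
    (y : 'cV[R]_n) : \bar R :=
  ereal_sup [set ((dotv u y)%:E - p u)%E | u in [set: 'cV[R]_n]].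

Definition prox_objective (R : realType) (n : nat) (beta : R)
    (p : 'cV[R]_n -> \bar R) (z w : 'cV[R]_n) : \bar R :=
  (p w + ((2 * beta)^-1 * enorm (w - z)%R ^+ 2)%:E)%E.

(* prox beta p z is the point of the argmin set, which is a singleton for every
   convex p in Gamma and beta > 0; the default 0 is used only if it is empty. *)
Definition prox (R : realType) (n : nat) (beta : R) (p : 'cV[R]_n -> \bar R)
    (z : 'cV[R]_n) : 'cV[R]_n :=
  xget 0 (argmin setT (prox_objective beta p z)).

Definition env (R : realType) (n : nat) (beta : R) (p : 'cV[R]_n -> \bar R)
    (z : 'cV[R]_n) : \bar R :=
  ereal_inf [set prox_objective beta p z w | w in [set: 'cV[R]_n]].

(* The nearest point, which exists and is unique for C nonempty, closed and
   convex; the default 0 is used only if there is none. *)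
Definition proj (R : realType) (d : nat) (C : set 'cV[R]_d) (v : 'cV[R]_d) :
    'cV[R]_d :=
  xget 0 (argmin C (fun w => (enorm (w - v)%R)%:E)).

(* No oo - oo arises for p in SPF, as env alpha p is then finite. *)
Definition env_diff (R : realType) (n : nat) (p : 'cV[R]_n -> \bar R)
    (alpha : R) (u : 'cV[R]_n) : \bar R :=
  (p u - env alpha p u)%E.

Definition objective (R : realType) (d n : nat) (z : 'cV[R]_d)
    (B : 'M[R]_(n, d)) (phi : 'cV[R]_n -> \bar R) (lambda alpha : R)
    (x : 'cV[R]_d) : \bar R :=
  (((2 * lambda)^-1 * enorm (x - z)%R ^+ 2)%:E + env_diff phi alpha (B *m x))%E.

(* Main.v *)
From mathcomp Require Import ring lra.
Require Import Defs.
Import Order.TTheory GRing.Theory Num.Theory.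
Import numFieldNormedType.Exports.
Local Open Scope classical_set_scope.
Local Open Scope ring_scope.

Set Implicit Arguments.
Unset Strict Implicit.
Unset Printing Implicit Defensive.

(** Since [lambda < alpha / ||B||^2], the function
    [F x = |x - z|^2 / (2 lambda) - env_alpha phi (B x)] is strongly convex with
    a [1/lambda]-Lipschitz gradient, and the iteration is a Condat-Vu splitting
    for [F + phi o B] over [C].  No dual solution needs to exist (there is no
    qualification condition), so the argument avoids Fejer monotonicity towards
    saddle points.  Write [r_k = (a_k, b_k)] for the residual
    [(x_k, y_k) - (xt_{k+1}, yt_{k+1})].
    - The squared norm of [r_k] in the metric of the preconditioner is
      nonincreasing, and by strong monotonicity of [grad F] it drops by a
      multiple of [|a_k|^2], so [sum |a_k|^2] is finite.
    - The Lagrangian at [(xt_{k+1}, yt_k)] increases by a multiple of [|b_k|^2]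
      up to terms controlled by [sum |a_k|^2] and is bounded above, so
      [sum |b_k|^2] is finite.
    - Hence [k |r_k|^2 -> 0] while [|y_k|^2 = O(k)], so the products of residuals
      and dual iterates vanish.  The primal-dual gap inequality then shows that
      every cluster point of [xt] minimizes the problem, and the minimizer is
      unique. *)

(** * Inner products, the spectral norm and cluster points in Euclidean space *)

Section EuclideanSpace.
Context {R : realType}.

Lemma dotvC n (u v : 'cV[R]_n) : dotv u v = dotv v u.
Proof. by apply: eq_bigr => i _; rewrite mulrC. Qed.

Lemma dotvDl n (u v w : 'cV[R]_n) : dotv (u + v) w = dotv u w + dotv v w.
Proof. by rewrite -big_split; apply: eq_bigr => i _; rewrite mxE mulrDl. Qed.

Lemma dotvDr n (u v w : 'cV[R]_n) : dotv w (u + v) = dotv w u + dotv w v.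
Proof. by rewrite dotvC dotvDl !(dotvC w). Qed.

Lemma dotvZl n t (u w : 'cV[R]_n) : dotv (t *: u) w = t * dotv u w.
Proof. by rewrite mulr_sumr; apply: eq_bigr => i _; rewrite mxE mulrA. Qed.

Lemma dotvZr n t (u w : 'cV[R]_n) : dotv w (t *: u) = t * dotv w u.
Proof. by rewrite dotvC dotvZl dotvC. Qed.

Lemma dotvNl n (u w : 'cV[R]_n) : dotv (- u) w = - dotv u w.
Proof. by rewrite -scaleN1r dotvZl mulN1r. Qed.

Lemma dotvNr n (u w : 'cV[R]_n) : dotv w (- u) = - dotv w u.
Proof. by rewrite dotvC dotvNl dotvC. Qed.

Definition dotvE := (@dotvDl, @dotvDr, @dotvNl, @dotvNr, @dotvZl, @dotvZr).

Lemma dotv_ge0 n (u : 'cV[R]_n) : 0 <= dotv u u.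
Proof. by apply: sumr_ge0 => i _; rewrite -expr2 sqr_ge0. Qed.

Lemma dotv_entry n (u : 'cV[R]_n) i : u i 0 ^+ 2 <= dotv u u.
Proof.
rewrite /dotv (bigD1 i)//= -expr2 lerDl.
by apply: sumr_ge0 => j _; rewrite -expr2 sqr_ge0.
Qed.

Lemma dotv_eq0 n (u : 'cV[R]_n) : dotv u u <= 0 -> u = 0.
Proof.
move=> u0; apply/matrixP => i j; rewrite ord1 mxE; apply/eqP.
rewrite -sqrf_eq0 eq_le sqr_ge0 andbT; exact: le_trans (dotv_entry u i) u0.
Qed.

Lemma dotv_young n (t : R) (u v : 'cV[R]_n) : 0 < t ->
  dotv u v <= t * dotv u u + (4 * t)^-1 * dotv v v.
Proof.
move=> t0; have := dotv_ge0 ((2 * t) *: u - v).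
rewrite !dotvE (dotvC v u) => h; rewrite -subr_ge0.
have -> : t * dotv u u + (4 * t)^-1 * dotv v v - dotv u v = (4 * t)^-1 *
   (2 * t * (2 * t * dotv u u) - 2 * t * dotv u v - (2 * t * dotv u v - dotv v v)).
  by field; lra.
by apply: mulr_ge0; [rewrite invr_ge0; lra|lra].
Qed.

Lemma dotv_sqrD n (u v : 'cV[R]_n) :
  dotv (u + v) (u + v) <= 2 * dotv u u + 2 * dotv v v.
Proof.
have := dotv_ge0 (u - v); rewrite !dotvE (dotvC v u); lra.
Qed.

Lemma dotv_sqrB n (u v : 'cV[R]_n) :
  dotv (u - v) (u - v) <= 2 * dotv u u + 2 * dotv v v.
Proof. by have := dotv_sqrD u (- v); rewrite dotvNl dotvNr opprK. Qed.

Lemma dotv_CauchySchwarz n (u v : 'cV[R]_n) :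
  dotv u v ^+ 2 <= dotv u u * dotv v v.
Proof.
have [v0|v0] := eqVneq v 0.
  rewrite v0 -[0 : 'cV_n](scale0r 0) !dotvZr dotvZl.
  by rewrite !mul0r expr0n/= mulr0.
have vv0 : 0 < dotv v v.
  rewrite lt_neqAle dotv_ge0 andbT eq_sym; apply: contraNneq v0 => vv0.
  by apply/eqP/dotv_eq0; rewrite vv0.
have := dotv_ge0 (dotv v v *: u - dotv u v *: v); rewrite !dotvE (dotvC v u) => h.
rewrite -(ler_pM2l vv0); lra.
Qed.

(** Induction: the cross term of the new summand with the partial sum is split by Young with weight
    [1 / (2 (k+1))]. It later turns summable dual residuals into linear growth of the squared dual
    iterates. *)
Lemma dotv_sum_le n (v : nat -> 'cV[R]_n) k :
  dotv (\sum_(0 <= j < k) v j) (\sum_(0 <= j < k) v j) <=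
  k%:R * \sum_(0 <= j < k) dotv (v j) (v j).
Proof.
elim: k => [|k IH].
  by rewrite !big_geq// mulr0 -[0 : 'cV_n](scale0r 0) dotvZl mul0r.
case: k IH => [|k] IH.
  by rewrite !big_nat1 mul1r.
rewrite !(big_nat_recr k.+1)//=.
set S := \sum_(0 <= j < k.+1) v j in IH *.
set T := \sum_(0 <= j < k.+1) dotv _ _ in IH *.
have k0 : 0 < k.+1%:R :> R by rewrite ltr0n.
have k1 : k.+2%:R = k.+1%:R + 1 :> R by rewrite -natr1.
have := @dotv_young _ (2 * k.+1%:R)^-1 S (v k.+1).
rewrite invr_gt0 mulr_gt0// => /(_ isT) y.
have e : (4 * (2 * (k.+1%:R : R))^-1)^-1 = k.+1%:R / 2 by field; lra.
rewrite e in y.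
have i2 : (2 * (k.+1%:R : R))^-1 = k.+1%:R^-1 / 2 by field; lra.
rewrite i2 in y.
have : k.+1%:R^-1 * dotv S S <= T by rewrite ler_pdivrMl.
rewrite !dotvE (dotvC (v k.+1)) k1.
move: y IH; set K : R := k.+1%:R; set ss := dotv S S; set sv := dotv S _.
set vv := dotv _ _; set iss := K^-1 * ss.
rewrite (_ : K^-1 / 2 * ss = iss / 2); last by rewrite /iss mulrAC.
lra.
Qed.

Lemma enorm_sqr n (u : 'cV[R]_n) : enorm u ^+ 2 = dotv u u.
Proof. by rewrite sqr_sqrtr// dotv_ge0. Qed.

Lemma dotv_mulmx n d (B : 'M[R]_(n, d)) x y :
  dotv (B *m x) y = dotv x (B^T *m y).
Proof.
rewrite /dotv (eq_bigr (fun i => \sum_j B i j * x j 0 * y i 0)); last first.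
  by move=> i _; rewrite mxE mulr_suml.
rewrite exchange_big/=; apply: eq_bigr => j _.
rewrite mxE mulr_sumr; apply: eq_bigr => i _.
by rewrite mxE; ring.
Qed.

Lemma dotv_trmxl n d (B : 'M[R]_(n, d)) x y :
  dotv (B^T *m y) x = dotv y (B *m x).
Proof. by rewrite dotvC -dotv_mulmx dotvC. Qed.

(** With [w = B^T y], [|w|^2] is the inner product of [B w] and [y]; Cauchy-Schwarz and the bound on
    [B w] leave one factor [|w|^2] to cancel. *)
Lemma dotv_trmx n d (B : 'M[R]_(n, d)) (kappa : R) : 0 <= kappa ->
  (forall x, dotv (B *m x) (B *m x) <= kappa * dotv x x) ->
  forall y, dotv (B^T *m y) (B^T *m y) <= kappa * dotv y y.
Proof.
move=> k0 hB y; set w := B^T *m y.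
have [w0|w0] := leP (dotv w w) 0.
  by apply: le_trans w0 _; rewrite mulr_ge0// dotv_ge0.
have e : dotv w w = dotv (B *m w) y by rewrite dotv_mulmx.
have := dotv_CauchySchwarz (B *m w) y; rewrite -e => cs.
have h : dotv (B *m w) (B *m w) * dotv y y <= kappa * dotv w w * dotv y y.
  by rewrite ler_wpM2r// dotv_ge0.
rewrite -(ler_pM2l w0); move: cs h; rewrite expr2; lra.
Qed.

Lemma spectral_norm_le n d (B : 'M[R]_(n, d)) x :
  dotv (B *m x) (B *m x) <= spectral_norm B ^+ 2 * dotv x x.
Proof.
(* The squared Frobenius norm shows that the set in the supremum is bounded, so [spectral_norm B] is
   indeed an upper bound of it. *)
pose M := \sum_i dotv (row i B)^T (row i B)^T.
have hM z : dotv (B *m z) (B *m z) <= M * dotv z z.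
  rewrite /M mulr_suml; apply: ler_sum => i _.
  have -> : (B *m z) i 0 = dotv (row i B)^T z.
    by rewrite mxE; apply: eq_bigr => j _; rewrite !mxE.
  by rewrite -expr2 dotv_CauchySchwarz.
have M0 : 0 <= M by apply: sumr_ge0 => i _; exact: dotv_ge0.
have ub z : enorm z <= 1 -> enorm (B *m z) <= spectral_norm B.
  move=> z1; apply: ub_le_sup; last by exists z.
  exists (Num.sqrt M) => _ [u /= u1 <-].
  rewrite ler_wsqrtr//; apply: le_trans (hM u) _.
  rewrite ler_piMr// -enorm_sqr -(expr1n _ 2) lerXn2r ?nnegrE ?sqrtr_ge0//.
have [x0|x0] := leP (dotv x x) 0.
  rewrite (dotv_eq0 x0) mulmx0.
  by rewrite -[0 : 'cV_n](scale0r 0) -[0 : 'cV_d](scale0r 0) !dotvZl !mul0r mulr0.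
have e0 : 0 < enorm x by rewrite sqrtr_gt0.
have nx : enorm ((enorm x)^-1 *: x) <= 1.
  have : dotv x x = enorm x ^+ 2 by rewrite enorm_sqr.
  move: (enorm x) e0 => t t0 xx; rewrite /enorm !dotvE xx (_ : _ * _ = 1) ?sqrtr1//.
  by field; exact: lt0r_neq0.
have := ub _ nx; rewrite -(@ler_pXn2r _ 2)// ?nnegrE ?sqrtr_ge0//; last first.
  by apply: le_trans (ub _ nx); exact: sqrtr_ge0.
rewrite enorm_sqr -scalemxAr !dotvE => h.
rewrite -(enorm_sqr x).
have e2 : 0 < enorm x ^+ 2 by rewrite exprn_gt0.
rewrite -ler_pdivrMr//; apply: le_trans h.
by rewrite mulrA -expr2 mulrC exprVn.
Qed.

Lemma ball_dotv n (u v : 'cV[R]_n) e : 0 < e ->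
  dotv (v - u) (v - u) < e ^+ 2 -> ball u e v.
Proof.
move=> e0 h; split => // i j; rewrite ord1 /ball/= -(@ltr_pXn2r _ 2)// ?nnegrE ?ltW//.
rewrite real_normK ?num_real//; apply: le_lt_trans h.
by have := dotv_entry (v - u) i; rewrite !mxE sqrrB sqrrB; lra.
Qed.

Lemma dotv_ball n (u v : 'cV[R]_n) e : ball u e v ->
  dotv (v - u) (v - u) <= n%:R * e ^+ 2.
Proof.
case=> e0 h; rewrite -[n in n%:R]card_ord mulr_natl -sumr_const.
apply: ler_sum => i _; have := ltW (h i 0); rewrite !mxE -expr2 => hi.
rewrite -(@ler_pXn2r _ 2) ?nnegrE// in hi; last exact: ltW.
by apply: le_trans hi; rewrite real_normK ?num_real// -sqrrN opprB.
Qed.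

Lemma nbhs_dotv n (u : 'cV[R]_n) (V : set 'cV[R]_n) : nbhs u V ->
  exists2 e : R, 0 < e & forall v, dotv (v - u) (v - u) < e -> V v.
Proof.
move=> /nbhs_ballP[e /= e0 h]; exists (e ^+ 2); first exact: exprn_gt0.
by move=> v hv; apply: h; exact: ball_dotv.
Qed.

Lemma cvg_dotv n (u : nat -> 'cV[R]_n) (l : 'cV[R]_n) :
  (forall e : R, 0 < e ->
     exists K, forall k, (K <= k)%N -> dotv (u k - l) (u k - l) < e) ->
  u @ \oo --> l.
Proof.
move=> h; apply/cvg_ballP => e e0.
have [K hK] := h (e ^+ 2) (exprn_gt0 _ e0).
by exists K => // k /= /hK; exact: ball_dotv.
Qed.

Definition cluster_pt n (u : nat -> 'cV[R]_n) (l : 'cV[R]_n) :=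
  forall (e : R) K, 0 < e ->
    exists2 k, (K <= k)%N & dotv (u k - l) (u k - l) < e.

(** Bolzano-Weierstrass by compactness of a box; the vectors are transposed because that box
    consists of row vectors. *)
Lemma bounded_cluster_pt n (u : nat -> 'cV[R]_n) (M : R) :
  (forall k, dotv (u k) (u k) <= M) -> exists l, cluster_pt u l.
Proof.
move=> hM; have M0 : 0 <= M := le_trans (dotv_ge0 _) (hM 0%N).
pose A := [set v : 'rV[R]_n | forall i, `[- (M + 1), M + 1]%classic (v ord0 i)].
have cA : compact A.
  apply: (@rV_compact _ _ (fun=> `[- (M + 1), M + 1]%classic)) => _.
  exact: segment_compact.
have : ((fun k => (u k)^T) @ \oo) A.
  exists 0%N => // k _ i /=; rewrite in_itv/= mxE -ler_norml.
  have : u k i 0 ^+ 2 <= (M + 1) ^+ 2.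
    apply: le_trans (dotv_entry _ i) _; apply: le_trans (hM k) _; nra.
  rewrite -real_normK ?num_real// ler_pXn2r ?nnegrE//; lra.
move=> /cA[l [_ cl]]; exists l^T => e K e0.
have [e' e'0 he'] : exists2 e' : R, 0 < e' & n%:R * e' ^+ 2 < e.
  exists (Num.min 1 (e / (n%:R + 1))).
    by rewrite lt_min ltr01/= divr_gt0// ltr_wpDl.
  set t := Num.min _ _; have t0 : 0 < t by rewrite lt_min ltr01/= divr_gt0// ltr_wpDl.
  have t1 : t <= 1 by rewrite ge_min lexx.
  have t2 : t * (n%:R + 1) <= e by rewrite -ler_pdivlMr ?ltr_wpDl// ge_min lexx orbT.
  have nn : 0 <= n%:R :> R by [].
  nra.
have [] := cl [set (u k)^T | k in [set k | (K <= k)%N]] (ball l e').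
- by exists K => // k /= Kk; exists k.
- exact: nbhsx_ballx.
move=> _ [[k /= Kk <-] b]; exists k => //.
apply: le_lt_trans he'; apply: dotv_ball.
by case: b => _ b; split => // i j; have := b j i; rewrite !mxE.
Qed.

(** Otherwise terms of arbitrarily large index stay away from [l]; a cluster point of those is one
    of [u], hence equals [l], a contradiction. *)
Lemma cvg_unique_cluster_pt n (u : nat -> 'cV[R]_n) (M : R) l :
  (forall k, dotv (u k) (u k) <= M) ->
  (forall l', cluster_pt u l' -> l' = l) ->
  forall e : R, 0 < e ->
    exists K, forall k, (K <= k)%N -> dotv (u k - l) (u k - l) < e.
Proof.
move=> hM uniq e e0; apply: contrapT => nK.
have /choice[s hs] : forall K, exists k, (K <= k)%N /\ e <= dotv (u k - l) (u k - l).
  move=> K; apply: contrapT => nk; apply: nK; exists K => k Kk.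
  by rewrite ltNge; apply/negP => ek; apply: nk; exists k.
have [l' cl'] := @bounded_cluster_pt _ (u \o s) M (fun k => hM _).
have ll' : l' = l.
  apply: uniq => e' K e'0; have [k Kk hk] := cl' e' K e'0.
  by exists (s k) => //; exact: leq_trans Kk (hs k).1.
have [k _] := cl' e 0%N e0; rewrite ll' /= ltNge.
by rewrite (hs k).2.
Qed.

End EuclideanSpace.

(** * Closed convex functions: subgradients, proximal points and projections *)

Section ClosedConvexFunctions.
Context {R : realType}.

(* A function with values in [0, +oo] is represented by its domain D and its
   real values f on D; the last field says that the epigraph is closed. *)
Record closed_convex n (D : set 'cV[R]_n) (f : 'cV[R]_n -> R) : Prop := {
  cc_neq0 : D !=set0;
  cc_ge0 : forall u, D u -> 0 <= f u;
  cc_convex : forall u v t, D u -> D v -> 0 <= t <= 1 ->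
    D (t *: u + (1 - t) *: v) /\
    f (t *: u + (1 - t) *: v) <= t * f u + (1 - t) * f v;
  cc_closed : forall l m,
    (forall e, 0 < e -> exists u, [/\ D u, dotv (u - l) (u - l) < e & f u <= m]) ->
    D l /\ f l <= m }.

(** For closed convex [f] this also says that [q] is a subgradient of the conjugate at [y]; values
    of the conjugate are computed from such a [q]. *)
Definition subgrad n (D : set 'cV[R]_n) (f : 'cV[R]_n -> R) (q y : 'cV[R]_n) :=
  D q /\ forall u, D u -> f q + dotv y (u - q) <= f u.

Lemma subgrad_mono n (D : set 'cV[R]_n) f q y q' y' :
  subgrad D f q y -> subgrad D f q' y' -> 0 <= dotv (y' - y) (q' - q).
Proof.
move=> [Dq hq] [Dq' hq']; have := hq _ Dq'; have := hq' _ Dq.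
by rewrite !dotvE; lra.
Qed.

(** The form in which the closed epigraph is used: an asymptotic bound on [f (w k)] near [l] passes
    to [l]. *)
Lemma closed_convex_cluster n (D : set 'cV[R]_n) f (w : nat -> 'cV[R]_n) l m :
  closed_convex D f -> (forall k, D (w k)) -> cluster_pt w l ->
  (forall e, 0 < e -> exists2 d, 0 < d &
     exists K, forall k, (K <= k)%N -> dotv (w k - l) (w k - l) < d ->
       f (w k) <= m + e) ->
  D l /\ f l <= m.
Proof.
move=> cc Dw cl h.
have hm e : 0 < e -> D l /\ f l <= m + e.
  move=> e0; have [d d0 [K hK]] := h e e0.
  apply: (cc_closed cc) => e' e'0.
  have m0 : 0 < Num.min d e' by rewrite lt_min d0.
  have [k Kk] := cl _ K m0; rewrite lt_min => /andP[kd ke].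
  by exists (w k); split => //; exact: hK.
split; first by case: (hm 1 ltr01).
by apply/ler_addgt0Pr => e e0; case: (hm e e0).
Qed.

Lemma dotv_near n (v l : 'cV[R]_n) e : 0 < e ->
  exists2 d, 0 < d & forall w, dotv (w - l) (w - l) < d ->
    dotv (l - v) (l - v) <= dotv (w - v) (w - v) + e.
Proof.
move=> e0; set c := dotv (l - v) (l - v).
have c0 : 0 <= c := dotv_ge0 _.
pose t := e / (4 * (c + 1)).
have t0 : 0 < t by rewrite divr_gt0//; lra.
have tc : t * c <= e / 4.
  rewrite /t mulrAC ler_pdivrMr; last lra.
  nra.
exists (e * t); first exact: mulr_gt0.
move=> w hw; have := dotv_young (l - v) (l - w) t0.
have -> : dotv (l - w) (l - w) = dotv (w - l) (w - l) by rewrite !dotvE; ring.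
have hw' : (4 * t)^-1 * dotv (w - l) (w - l) <= e / 4.
  rewrite ler_pdivrMl; last lra.
  move: hw; set x := dotv _ _; nra.
have := dotv_ge0 (w - l).
rewrite -/c.
have : dotv (w - v) (w - v) = c - 2 * dotv (l - v) (l - w) + dotv (w - l) (w - l).
  by rewrite /c !dotvE (dotvC l v) (dotvC l w) (dotvC w v); ring.
lra.
Qed.

(** A minimizing sequence of [f + |. - v|^2 / (2 beta)] is bounded, and a cluster point minimizes by
    closedness. Comparing it with points on shrinking segments towards [u] gives the subgradient
    inequality. *)
Lemma prox_exists n (D : set 'cV[R]_n) f (beta : R) v :
  closed_convex D f -> 0 < beta ->
  exists p, subgrad D f p (beta^-1 *: (v - p)).
Proof.
move=> cc b0; pose g : R := (2 * beta)^-1.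
have g0 : 0 < g by rewrite invr_gt0; lra.
pose h w := f w + g * dotv (w - v) (w - v).
pose E := [set h w | w in D].
have h0 w : D w -> 0 <= h w.
  by move=> Dw; rewrite addr_ge0 ?(cc_ge0 cc)// mulr_ge0 ?dotv_ge0 ?ltW.
have infE : has_inf E.
  split; first by have [u Du] := cc_neq0 cc; exists (h u), u.
  by exists 0 => _ [w Dw <-]; exact: h0.
have lbE w : D w -> inf E <= h w by move=> Dw; apply: ge_inf; [case: infE|exists w].
have /choice[w hw] : forall k, exists w, D w /\ h w < inf E + k.+1%:R^-1.
  move=> k; have k0 : 0 < k.+1%:R^-1 :> R by rewrite invr_gt0.
  by have [_ [w Dw <-] hw] := inf_adherent k0 infE; exists w.
have bw k : dotv (w k - v) (w k - v) <= (inf E + 1) / g.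
  rewrite ler_pdivlMr//.
  have [Dw] := hw k; have := cc_ge0 cc Dw.
  have : k.+1%:R^-1 <= 1 :> R by rewrite invf_le1// ler1n.
  rewrite /h; set x := k.+1%:R^-1; lra.
have bw' k : dotv (w k) (w k) <= 2 * ((inf E + 1) / g) + 2 * dotv v v.
  by have := dotv_sqrD (w k - v) v; rewrite subrK; have := bw k; lra.
have [p clp] := bounded_cluster_pt bw'.
have [Dp hp] : D p /\ f p <= inf E - g * dotv (p - v) (p - v).
  apply: (closed_convex_cluster cc (fun k => (hw k).1) clp) => e e0.
  have eg0 : 0 < e / (2 * g) by rewrite divr_gt0//; lra.
  have [d d0 hd] := dotv_near v p eg0; exists d => //.
  have e2 : 0 < e / 2 by lra.
  have [K _ hK] := near_infty_natSinv_lt (PosNum e2); exists K => // k /hK /= kK /hd hk.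
  have := (hw k).2; rewrite /h.
  have : g * dotv (p - v) (p - v) <= g * (dotv (w k - v) (w k - v) + e / (2 * g)).
    by rewrite ler_pM2l.
  have -> : g * (dotv (w k - v) (w k - v) + e / (2 * g)) =
            g * dotv (w k - v) (w k - v) + e / 2 by field; exact: lt0r_neq0.
  move: kK; set x := k.+1%:R^-1; lra.
exists p; split => // u Du.
have key t : 0 < t -> t <= 1 ->
    f p <= f u + 2 * g * dotv (p - v) (u - p) + g * t * dotv (u - p) (u - p).
  move=> t0 t1; have [|Dt ft] := @cc_convex _ _ _ cc u p t Du Dp; first lra.
  have := lbE _ Dt; rewrite /h.
  have -> : t *: u + (1 - t) *: p - v = (p - v) + t *: (u - p).
    by apply/matrixP => i j; rewrite !mxE; ring.
  move: (p - v) (u - p) hp => a b hp.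
  by rewrite !dotvE (dotvC b a) => hl; rewrite -(ler_pM2l t0); lra.
have -> : dotv (beta^-1 *: (v - p)) (u - p) = - (2 * g * dotv (p - v) (u - p)).
  rewrite dotvZl -opprB dotvNl /g; field; exact: lt0r_neq0.
set s := dotv (p - v) (u - p) in key *; set q := dotv (u - p) (u - p) in key.
have q0 : 0 <= q := dotv_ge0 _.
apply/ler_addgt0Pr => e e0.
(* Small enough that the quadratic remainder [g * t * q] is at most [e]. *)
pose t := Num.min 1 (e / (g * q + 1)).
have gq : 0 <= g * q by rewrite mulr_ge0// ltW.
have t0 : 0 < t by rewrite lt_min ltr01/= divr_gt0//; lra.
have t1 : t <= 1 by rewrite ge_min lexx.
have te : t * (g * q + 1) <= e by rewrite -ler_pdivlMr ?ge_min ?lexx ?orbT//; lra.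
have := key t t0 t1; lra.
Qed.

Lemma closed_convex_set d (C : set 'cV[R]_d) :
  C !=set0 -> closed C -> convex_set C -> closed_convex C (fun=> 0).
Proof.
move=> C0 Ccl Ccv; split => //.
- move=> u v t Cu Cv t01; split; last by rewrite !mulr0 addr0.
  case/andP: t01 => t0 t1.
  have := Ccv u v (Itv01 t0 t1) (mem_set Cu) (mem_set Cv).
  exact: set_mem.
- move=> l m h; split; last by have [u []] := h 1 ltr01.
  apply: Ccl => V /nbhs_dotv[e e0 hV].
  by have [u [Cu lu _]] := h e e0; exists u; split => //; exact: hV.
Qed.

(** The projection is the proximal point of the zero function on [C], and the obtuse-angle
    inequality makes it the only nearest point. *)
Lemma projP d (C : set 'cV[R]_d) v : closed_convex C (fun=> 0) ->
  C (proj C v) /\ forall c, C c -> dotv (v - proj C v) (c - proj C v) <= 0.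
Proof.
move=> cc; have [p [Cp hp]] := prox_exists v cc ltr01.
have {}hp c : C c -> dotv (v - p) (c - p) <= 0.
  by move=> /hp; rewrite dotvZl invr1 mul1r add0r.
have sq w : dotv (w - v) (w - v) =
    dotv (p - v) (p - v) - 2 * dotv (v - p) (w - p) + dotv (w - p) (w - p).
  by rewrite !dotvE (dotvC v w) (dotvC p w) (dotvC v p); ring.
suff -> : proj C v = p by split.
apply: xget_unique.
  split => // w Cw; rewrite lee_fin ler_sqrt ?dotv_ge0//.
  by rewrite (sq w); have := hp _ Cw; have := dotv_ge0 (w - p); lra.
move=> w [Cw hw]; apply/eqP; rewrite -subr_eq0; apply/eqP/dotv_eq0.
have := hw _ Cp; rewrite lee_fin ler_sqrt ?dotv_ge0//.
by rewrite (sq w); have := hp _ Cw; lra.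
Qed.

(** * Fenchel conjugate and Moreau envelope of a sparsity promoting function *)

Section Conjugate.
Context {n : nat} (phi : 'cV[R]_n -> \bar R).
Context (phi_SPF : SPF phi) (phi_convex : econvex phi).

Let D := [set u | (phi u < +oo)%E].
Let f u := fine (phi u).

Lemma SPF_ge0 u : (0 <= phi u)%E.
Proof. by case: phi_SPF => _ []. Qed.

Lemma SPF_fineK u : D u -> phi u = (f u)%:E.
Proof. by move=> Du; rewrite fineK// ge0_fin_numE// SPF_ge0. Qed.

Lemma domPn_pinfty u : ~ D u -> phi u = +oo%E.
Proof. by move=> /negP; rewrite -leNgt leye_eq => /eqP. Qed.

Lemma SPF_closed_convex : closed_convex D f.
Proof.
split.
- by case: phi_SPF => -[].
- by move=> u Du; rewrite -lee_fin -SPF_fineK// SPF_ge0.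
- move=> u v t Du Dv t01; have := phi_convex u v t01.
  rewrite (SPF_fineK Du) (SPF_fineK Dv) -!EFinM -EFinD => h.
  have Dt : D (t *: u + (1 - t) *: v) by apply: le_lt_trans h _; rewrite ltry.
  by split => //; rewrite -lee_fin -SPF_fineK.
- move=> l m h.
  have hl : (phi l <= m%:E)%E.
    rewrite leNgt; apply/negP => ml.
    have [[_ _ lsc] _ _] := phi_SPF.
    have [V /nbhs_dotv[e e0 hV] Vm] := lsc _ _ ml.
    have [u [Du lu fu]] := h e e0.
    by have := Vm _ (hV _ lu); rewrite (SPF_fineK Du) lte_fin ltNge fu.
  have Dl : D l by apply: le_lt_trans hl _; rewrite ltry.
  by split => //; rewrite -lee_fin -SPF_fineK.
Qed.

(** The equality case of the Fenchel-Young inequality. *)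
Lemma fconj_subgrad q y : subgrad D f q y ->
  fconj phi y = (dotv q y - f q)%:E.
Proof.
move=> [Dq hq]; apply/eqP; rewrite eq_le; apply/andP; split.
  apply: ge_ereal_sup => _ [u _ <-].
  have [Du|nDu] := pselect (D u); last by rewrite (domPn_pinfty nDu) /= leNye.
  rewrite (SPF_fineK Du) -EFinB lee_fin.
  by have := hq _ Du; rewrite !dotvE (dotvC u) (dotvC q); lra.
by apply: ereal_sup_ubound; exists q => //; rewrite (SPF_fineK Dq) EFinB.
Qed.

Lemma fconj_ge q y : D q -> ((dotv q y - f q)%:E <= fconj phi y)%E.
Proof.
by move=> Dq; apply: ereal_sup_ubound; exists q => //; rewrite (SPF_fineK Dq) EFinB.
Qed.

(* Moreau decomposition *)
Lemma prox_fconjP sigma v : 0 < sigma ->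
  exists2 q, subgrad D f q (v - sigma *: q) &
    prox sigma (fconj phi) v = v - sigma *: q.
Proof.
move=> s0; have is0 : 0 < sigma^-1 by rewrite invr_gt0.
have [q] := prox_exists (sigma^-1 *: v) SPF_closed_convex is0.
rewrite invrK scalerBr scalerA divff ?lt0r_neq0// scale1r => hq; exists q => //.
set y := v - sigma *: q in hq *.
have Dq : D q := hq.1.
(* The conjugate lies above the affine function of slope [q] that touches it at [y], so the
   objective grows at least quadratically away from [y]; this gives both minimality and
   uniqueness. *)
have key w : (prox_objective sigma (fconj phi) v y
    + ((2 * sigma)^-1 * dotv (w - y) (w - y))%:E
    <= prox_objective sigma (fconj phi) v w)%E.
  rewrite /prox_objective (fconj_subgrad hq) !enorm_sqr.
  apply: (@le_trans _ _ ((dotv q w - f q)%:E +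
     ((2 * sigma)^-1 * dotv (w - v) (w - v))%:E)%E); last first.
    by rewrite leeD2r// fconj_ge.
  rewrite -!EFinD lee_fin le_eqVlt; apply/orP; left; apply/eqP.
  rewrite /y !dotvE (dotvC v w) (dotvC q v) (dotvC w q); field.
  exact: lt0r_neq0.
have fy : (prox_objective sigma (fconj phi) v y) \is a fin_num.
  by rewrite /prox_objective (fconj_subgrad hq) -EFinD.
have c0 : 0 < (2 * sigma)^-1 by rewrite invr_gt0; lra.
apply: xget_unique.
  split => // w _; apply: le_trans (key w); rewrite leeDl// lee_fin.
  by rewrite mulr_ge0 ?dotv_ge0// ltW.
move=> w [_ /(_ y I) hw]; have := le_trans (key w) hw.
rewrite -[leRHS]adde0 leeD2lE// lee_fin pmulr_rle0// => /dotv_eq0 /eqP.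
by rewrite subr_eq0 => /eqP.
Qed.

Lemma env_subgrad alpha u p : 0 < alpha ->
  subgrad D f p (alpha^-1 *: (u - p)) ->
  env alpha phi u = (f p + (2 * alpha)^-1 * dotv (p - u) (p - u))%:E.
Proof.
move=> a0 [Dp hp]; apply/eqP; rewrite eq_le; apply/andP; split.
  apply: ereal_inf_lbound; exists p => //.
  by rewrite /prox_objective (SPF_fineK Dp) enorm_sqr.
apply: le_ereal_inf_tmp => _ [w _ <-]; rewrite /prox_objective.
have [Dw|nDw] := pselect (D w); last by rewrite (domPn_pinfty nDw) leey.
rewrite (SPF_fineK Dw) enorm_sqr -EFinD lee_fin.
have := hp _ Dw; rewrite dotvZl.
have c0 : 0 < (2 * alpha)^-1 by rewrite invr_gt0; lra.
have -> : alpha^-1 = 2 * (2 * alpha)^-1 by field; exact: lt0r_neq0.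
have : 0 <= (2 * alpha)^-1 * dotv (w - p) (w - p) by rewrite mulr_ge0 ?dotv_ge0 ?ltW.
have -> : dotv (w - u) (w - u) = dotv (p - u) (p - u) - 2 * dotv (u - p) (w - p)
   + dotv (w - p) (w - p).
  by rewrite !dotvE (dotvC u w) (dotvC p w) (dotvC u p); ring.
lra.
Qed.

End Conjugate.

End ClosedConvexFunctions.

(** * Real sequences: telescoping and summability *)

Section SummableSequences.
Context {R : realType}.

Lemma telescope_le (u v : nat -> R) (S : R) K :
  (forall k, v k <= u k.+1 - u k) -> (forall k, u k <= S) ->
  \sum_(0 <= j < K) v j <= S - u 0%N.
Proof.
move=> huv uS; apply: (@le_trans _ _ (u K - u 0%N)); last by have := uS K; lra.
by rewrite -telescope_sumr//; apply: ler_sum_nat => j _; exact: huv.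
Qed.

(** Each of the [k + 1 - m] terms from [m] to [k] is at least [u k], so a block sum bounds that
    multiple of [u k]. The choice [m = 0] gives the uniform bound, a fixed [m] with small tail the
    limit. *)
Lemma nonincreasing_summable (u : nat -> R) (S : R) :
  (forall k, 0 <= u k) -> (forall k, u k.+1 <= u k) ->
  (forall K, \sum_(0 <= j < K) u j <= S) ->
  (forall k, k.+1%:R * u k <= S) /\
  (forall e, 0 < e -> exists K, forall k, (K <= k)%N -> k.+1%:R * u k < e).
Proof.
move=> u0 uS hS.
have mono j k : (j <= k)%N -> u k <= u j.
  by move/subnK <-; elim: (k - j)%N => // i IH; apply: le_trans IH; rewrite addSn.
have blk m k : (m <= k)%N -> (k.+1 - m)%:R * u k <= \sum_(m <= j < k.+1) u j.
  move=> mk; rewrite mulr_natl -sumr_const_nat.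
  by apply: ler_sum_nat => j /andP[_]; rewrite ltnS; exact: mono.
split=> [k|e e0]; first by apply: le_trans (hS k.+1); rewrite -[in leLHS](subn0 k.+1); exact: blk.
pose E := [set \sum_(0 <= j < K) u j | K in setT].
have supE : has_sup E by split; [exists (\sum_(0 <= j < 0) u j), 0%N|exists S => _ [K _ <-]].
have e4 : 0 < e / 4 by lra.
have [_ [m _ <-] hm] := sup_adherent e4 supE.
(* From [2 m] on the block covers at least half of the indices, which costs a factor 2. *)
exists (2 * m)%N => k mk.
have mk' : (m <= k)%N by apply: leq_trans mk; rewrite leq_pmull.
have := blk _ _ mk'.
have : \sum_(0 <= j < k.+1) u j <= sup E.
  by apply: ub_le_sup; [case: supE|exists k.+1].
rewrite (big_cat_nat (n := m))//=; last exact: leq_trans mk' _.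
have : k.+1%:R * u k <= 2 * ((k.+1 - m)%:R * u k).
  rewrite mulrA ler_wpM2r// -natrM ler_nat mulnBr leq_subRL; last first.
    by rewrite leq_mul2l/= (leq_trans mk').
  by rewrite [(2 * k.+1)%N]mul2n -addnn leq_add2r leqW.
lra.
Qed.

End SummableSequences.

(** * Convergence of the primal-dual iteration for a closed convex function *)

Section PrimalDualSplitting.
Context {R : realType} {d n : nat} (C : set 'cV[R]_d) (D : set 'cV[R]_n).
Context (f : 'cV[R]_n -> R) (z : 'cV[R]_d) (B : 'M[R]_(n, d)).
Context (kappa lambda alpha tau sigma rho : R).
Context (C_cc : closed_convex C (fun=> 0)) (D_cc : closed_convex D f).
Context (kappa_ge0 : 0 <= kappa) (lambda_gt0 : 0 < lambda).
Context (alpha_gt0 : 0 < alpha) (tau_gt0 : 0 < tau) (sigma_gt0 : 0 < sigma).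
Context (rho_gt0 : 0 < rho) (rho_le1 : rho <= 1).
Context (B_kappa : forall x, dotv (B *m x) (B *m x) <= kappa * dotv x x).
Context (kappa_lt : lambda * kappa < alpha).
Context (cond_i : (2 * lambda)^-1 < tau^-1 - sigma * kappa).

Variable p : 'cV[R]_n -> 'cV[R]_n.
Hypothesis pP : forall u, subgrad D f (p u) (alpha^-1 *: (u - p u)).

(** Here [p u] is the proximal point at [u], [ev] the Moreau envelope, [s] its gradient, [F] the
    smooth part of the objective, [g] its gradient, [mu] its modulus of strong convexity; [m] bounds
    the preconditioner below on primal vectors. *)
Let s u := alpha^-1 *: (u - p u).
Let ev u := f (p u) + (2 * alpha)^-1 * dotv (p u - u) (p u - u).
Let F x := (2 * lambda)^-1 * dotv (x - z) (x - z) - ev (B *m x).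
Let g x := lambda^-1 *: (x - z) - B^T *m s (B *m x).
Let mu := lambda^-1 - kappa / alpha.
Let m := tau^-1 - sigma * kappa.

Let mu_gt0 : 0 < mu.
Proof.
by rewrite subr_gt0 ltr_pdivrMr// ltr_pdivlMl.
Qed.

Let m_gt0 : 0 < m.
Proof. by apply: lt_trans cond_i; rewrite invr_gt0 mulr_gt0. Qed.

(** [p u] is a competitor in the infimum defining [ev u']; expanding its quadratic around [u] gives
    the bound. *)
Lemma env_descent u u' :
  ev u' <= ev u + dotv (s u) (u' - u) + (2 * alpha)^-1 * dotv (u' - u) (u' - u).
Proof.
have [_ /(_ _ (pP u).1)] := pP u'.
have -> : alpha^-1 = 2 * (2 * alpha)^-1 by field; exact: lt0r_neq0.
set c := (2 * alpha)^-1; have c0 : 0 < c by rewrite invr_gt0 mulr_gt0.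
have h : 0 <= c * dotv (p u - p u') (p u - p u') by rewrite mulr_ge0 ?dotv_ge0// ltW.
rewrite /ev /s (_ : alpha^-1 = 2 * c); last by rewrite /c; field; exact: lt0r_neq0.
move: h; rewrite -/c !dotvE.
rewrite (dotvC (p u') u') (dotvC (p u') (p u)) (dotvC (p u) u') (dotvC u u').
rewrite (dotvC (p u) u); lra.
Qed.

(** The quadratic term has curvature [1 / lambda], of which the envelope composed with [B] takes
    away at most [kappa / alpha]. *)
Lemma smooth_strongly_convex x x' :
  F x + dotv (g x) (x' - x) + mu / 2 * dotv (x' - x) (x' - x) <= F x'.
Proof.
have := env_descent (B *m x) (B *m x'); rewrite -mulmxBr => h.
have hB := B_kappa (x' - x).
have {hB} : (2 * alpha)^-1 * dotv (B *m (x' - x)) (B *m (x' - x)) <=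
    (2 * alpha)^-1 * (kappa * dotv (x' - x) (x' - x)).
  by rewrite ler_pM2l// invr_gt0 mulr_gt0.
have -> : (2 * alpha)^-1 * (kappa * dotv (x' - x) (x' - x)) =
  kappa / alpha / 2 * dotv (x' - x) (x' - x) by field; exact: lt0r_neq0.
have -> : dotv (g x) (x' - x) =
    lambda^-1 * dotv (x - z) (x' - x) - dotv (s (B *m x)) (B *m (x' - x)).
  by rewrite /g dotvDl dotvNl dotvZl dotv_trmxl.
rewrite /F /mu.
have -> : dotv (x' - z) (x' - z) = dotv (x - z) (x - z) + 2 * dotv (x - z) (x' - x)
    + dotv (x' - x) (x' - x).
  by rewrite !dotvE (dotvC z x') (dotvC z x) (dotvC x' x); ring.
have -> : (2 * lambda)^-1 = lambda^-1 / 2 by field; exact: lt0r_neq0.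
lra.
Qed.

Lemma grad_strongly_monotone x x' :
  mu * dotv (x' - x) (x' - x) <= dotv (g x' - g x) (x' - x).
Proof.
have := smooth_strongly_convex x x'; have := smooth_strongly_convex x' x.
have -> : dotv (x - x') (x - x') = dotv (x' - x) (x' - x) by rewrite !dotvE; ring.
by rewrite (dotvDl (g x')) dotvNl -(opprB x' x) (dotvNr (x' - x)); lra.
Qed.

(** The right side minus the left is the inner product of [w] and [B h] minus [lambda |B^T w|^2],
    where [w] is the increment of [s] and [h] that of [x]. Monotonicity of subgradients bounds that
    product below by [alpha |w|^2], and [lambda kappa < alpha] concludes. *)
Lemma grad_cocoercive x x' :
  lambda * dotv (g x' - g x) (g x' - g x) <= dotv (g x' - g x) (x' - x).
Proof.
have gE : g x' - g x = lambda^-1 *: (x' - x) - B^T *m (s (B *m x') - s (B *m x)).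
  rewrite /g mulmxBr !scalerBr; move: (_ *m s _) (_ *m s _) => u v.
  by apply/matrixP => i j; rewrite !mxE; ring.
have mono := subgrad_mono (pP (B *m x)) (pP (B *m x')).
have uE : B *m (x' - x) = (p (B *m x') - p (B *m x)) + alpha *: (s (B *m x') - s (B *m x)).
  rewrite /s -scalerBr scalerA divff ?lt0r_neq0// scale1r mulmxBr.
  by apply/matrixP => i j; rewrite !mxE; ring.
move: mono; rewrite -/(s _) -/(s _) gE.
move: (s (B *m x') - s _) (p _ - p _) (x' - x) uE => w q h uE mono.
have wu : alpha * dotv w w <= dotv w (B *m h) by rewrite uE !dotvE; lra.
have ww : dotv (B^T *m w) (B^T *m w) <= kappa * dotv w w := dotv_trmx kappa_ge0 B_kappa w.
have w0 := dotv_ge0 w.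
rewrite !dotvE (dotvC h (B^T *m w)) dotv_trmxl.
set hh := dotv h h; set wh := dotv w (B *m h).
have : lambda * dotv (B^T *m w) (B^T *m w) <= dotv w (B *m h).
  apply: le_trans wu; apply: le_trans (_ : lambda * (kappa * dotv w w) <= _).
    by rewrite ler_pM2l.
  by rewrite mulrA ler_wpM2r// ltW.
rewrite -/wh => h1.
rewrite -subr_ge0 (_ : _ - _ = wh - lambda * dotv (B^T *m w) (B^T *m w)) ?subr_ge0//.
by field; exact: lt0r_neq0.
Qed.

Lemma grad_lipschitz x x' :
  dotv (g x' - g x) (g x' - g x) <= lambda^-1 ^+ 2 * dotv (x' - x) (x' - x).
Proof.
have l2 : 0 < lambda / 2 by rewrite divr_gt0.
have := dotv_young (g x' - g x) (x' - x) l2; have := grad_cocoercive x x'.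
move: (g x' - g x) (x' - x) => u v h1 h2.
have : lambda / 2 * dotv u u <= (4 * (lambda / 2))^-1 * dotv v v by lra.
rewrite -(ler_pM2l (_ : 0 < 2 / lambda)) ?divr_gt0//.
by congr (_ <= _); field; exact: lt0r_neq0.
Qed.

(** * Optimality conditions of one iteration and decrease of the residuals *)

Variables (x X : nat -> 'cV[R]_d) (y Y q : nat -> 'cV[R]_n).
Let a k := x k - X k.
Let b k := y k - Y k.
Hypothesis XC : forall k, C (X k).
Hypothesis XP : forall k c, C c ->
  dotv (tau^-1 *: a k - g (x k) - B^T *m y k) (c - X k) <= 0.
Hypothesis qE : forall k, q k = sigma^-1 *: b k + B *m X k - B *m a k.
Hypothesis YP : forall k, subgrad D f (q k) (Y k).
Hypothesis xS : forall k, x k.+1 = x k - rho *: a k.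
Hypothesis yS : forall k, y k.+1 = y k - rho *: b k.

(** The squared norm of the Condat-Vu preconditioner, the block matrix with diagonal [1/tau],
    [1/sigma] and off-diagonal [-B^T], [-B]. *)
Let pnorm (u : 'cV[R]_d) (v : 'cV[R]_n) :=
  tau^-1 * dotv u u - 2 * dotv (B *m u) v + sigma^-1 * dotv v v.

Lemma pnorm_ge u v :
  m * dotv u u + sigma^-1 * dotv (v - sigma *: (B *m u)) (v - sigma *: (B *m u))
    <= pnorm u v.
Proof.
have := B_kappa u; rewrite -(ler_pM2l sigma_gt0) /pnorm /m.
have -> : sigma^-1 * dotv (v - sigma *: (B *m u)) (v - sigma *: (B *m u)) =
    sigma^-1 * dotv v v - 2 * dotv (B *m u) v + sigma * dotv (B *m u) (B *m u).
  by rewrite !dotvE (dotvC v (B *m u)); field; exact: lt0r_neq0.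
lra.
Qed.

Lemma pnorm_ge_m u v : m * dotv u u <= pnorm u v.
Proof.
apply: le_trans (pnorm_ge u v); rewrite lerDl.
by rewrite mulr_ge0 ?dotv_ge0// invr_ge0 ltW.
Qed.

Lemma pnorm_ge0 u v : 0 <= pnorm u v.
Proof. by apply: le_trans (pnorm_ge_m u v); rewrite mulr_ge0 ?dotv_ge0// ltW. Qed.

(* The share of strong monotonicity that remains when [1 - theta] of the
   cocoercivity is spent on absorbing the cross term [dotv dg du]. *)
Let theta := 1 - (2 * lambda * m)^-1.

Let theta_gt0 : 0 < theta.
Proof.
rewrite subr_gt0 invf_lt1; last by rewrite !mulr_gt0.
have l2 : 0 < 2 * lambda by rewrite mulr_gt0.
by move: cond_i; rewrite -/m -(ltr_pM2l l2) divff// lt0r_neq0.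
Qed.

(** Residuals [u], [v] change by [du], [dv] in one step, and the gradient by [dg]. The first two
    hypotheses express monotonicity of the normal cone of [C] and of the subdifferential of the
    conjugate; their sum bounds [rho Q + pnorm du dv] by terms in [dg], where [Q] is the polar form.
    Young and cocoercivity absorb [dotv dg du]. *)
Lemma pnorm_decrease_vec (u du dg : 'cV[R]_d) (v dv : 'cV[R]_n) :
  0 <= dotv (tau^-1 *: du - dg + rho *: (B^T *m v)) (- (rho *: u) - du) ->
  0 <= dotv (- (rho *: v) - dv)
         (sigma^-1 *: dv + B *m (- (rho *: u) - du) - B *m du) ->
  lambda * dotv dg dg <= dotv dg (- (rho *: u)) ->
  mu * (rho ^+ 2 * dotv u u) <= dotv dg (- (rho *: u)) ->
  pnorm (u + du) (v + dv) <= pnorm u v - 2 * theta * mu * rho * dotv u u.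
Proof.
move=> H1 H2 H3 H4.
have mi : 0 < (2 * m)^-1 by rewrite invr_gt0 mulr_gt0.
have Y1 := dotv_young dg du mi.
have H5 := pnorm_ge_m du dv; have H6 := pnorm_ge0 du dv.
have th1 : 1 - theta = (2 * lambda * m)^-1 by rewrite /theta; ring.
have th0 : 0 <= 1 - theta by rewrite th1 invr_ge0 ltW// !mulr_gt0.
have {}H3 : (2 * m)^-1 * dotv dg dg <= (1 - theta) * dotv dg (- (rho *: u)).
  apply: le_trans (ler_wpM2l th0 H3); rewrite th1 le_eqVlt; apply/orP; left; apply/eqP.
  by field; rewrite !lt0r_neq0.
have {}H4 := ler_wpM2l (ltW theta_gt0) H4.
have mE : (4 * (2 * m)^-1)^-1 = m / 2 by field; exact: lt0r_neq0.
rewrite mE in Y1.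
have e1 : dotv (B^T *m v) u = dotv (B *m u) v by rewrite dotv_trmxl dotvC.
have e2 : dotv (B^T *m v) du = dotv (B *m du) v by rewrite dotv_trmxl dotvC.
pose Q := tau^-1 * dotv u du - dotv (B *m u) dv - dotv (B *m du) v + sigma^-1 * dotv v dv.
have NE : pnorm (u + du) (v + dv) = pnorm u v + 2 * Q + pnorm du dv.
  by rewrite /pnorm /Q mulmxDr !dotvE (dotvC du u) (dotvC dv v); ring.
have key : rho * Q <= - (pnorm du dv / 2) - theta * mu * rho ^+ 2 * dotv u u.
  move: H1 H2 H3 H4 H5 Y1; rewrite /pnorm /Q mulmxDr !mulmxN -scalemxAr !dotvE e1 e2.
  rewrite (dotvC du u) (dotvC v (B *m u)) (dotvC v (B *m du)) (dotvC dv (B *m u)).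
  rewrite (dotvC dv (B *m du)).
  set guu := dotv dg u; lra.
rewrite NE -subr_ge0 -(pmulr_rge0 _ rho_gt0).
(* This uses [rho <= 1]: the cross term removes [pnorm du dv / rho], while the expansion adds back
   only [pnorm du dv]. *)
have : 0 <= (1 - rho) * pnorm du dv by rewrite mulr_ge0// subr_ge0.
by move: key; lra.
Qed.

Lemma pnorm_decrease k :
  pnorm (a k.+1) (b k.+1) <=
  pnorm (a k) (b k) - 2 * theta * mu * rho * dotv (a k) (a k).
Proof.
have XE : X k.+1 - X k = - (rho *: a k) - (a k.+1 - a k).
  by rewrite /a xS /a; apply/matrixP => i j; rewrite !mxE; ring.
have YE : Y k.+1 - Y k = - (rho *: b k) - (b k.+1 - b k).
  by rewrite /b yS /b; apply/matrixP => i j; rewrite !mxE; ring.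
have xE : x k.+1 - x k = - (rho *: a k) by rewrite xS addrAC subrr add0r.
have -> : a k.+1 = a k + (a k.+1 - a k) by rewrite addrC subrK.
have -> : b k.+1 = b k + (b k.+1 - b k) by rewrite addrC subrK.
apply: (@pnorm_decrease_vec _ _ (g (x k.+1) - g (x k))).
- have := XP k (XC k.+1); have := XP k.+1 (XC k); rewrite -XE.
  rewrite yS -[X k - X k.+1]opprB mulmxBr -scalemxAr.
  move: (X k.+1 - X k) (g (x k.+1)) (g (x k)) (a k.+1) (a k) => w g1 g2 a1 a2.
  by rewrite !dotvE; lra.
- have := subgrad_mono (YP k) (YP k.+1); rewrite -YE -XE !qE.
  congr (0 <= dotv _ _); rewrite (mulmxBr B (X k.+1)) (mulmxBr B (a k.+1)).
  move: (B *m a k.+1) (B *m a k) (B *m X k.+1) (B *m X k) => u1 u2 u3 u4.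
  by apply/matrixP => i j; rewrite !mxE; ring.
- by rewrite -xE; exact: grad_cocoercive.
- have := grad_strongly_monotone (x k) (x k.+1); rewrite xE.
  move: (g _ - g _) (a k) => w u; rewrite !dotvE => h; apply: le_trans h.
  by rewrite expr2; lra.
Qed.

Lemma sum_primal_residual_le K : \sum_(0 <= j < K) dotv (a j) (a j) <=
  pnorm (a 0%N) (b 0%N) / (2 * theta * mu * rho).
Proof.
have c0 : 0 < 2 * theta * mu * rho by rewrite !mulr_gt0.
rewrite ler_pdivlMr// mulrC mulr_sumr.
rewrite -[leRHS]add0r -[X in 0 + X]opprK.
apply: (@telescope_le _ (fun k => - pnorm (a k) (b k))) => k.
  by have := pnorm_decrease k; lra.
by rewrite oppr_le0 pnorm_ge0.
Qed.

Lemma pnorm_le0 k : pnorm (a k) (b k) <= pnorm (a 0%N) (b 0%N).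
Proof.
elim: k => // k IH; apply: le_trans IH; apply: le_trans (pnorm_decrease k) _.
by rewrite gerBl !mulr_ge0 ?dotv_ge0 ?ltW.
Qed.

(** The dual vector is recovered from the completed square by adding [sigma B u], which the primal
    bound controls. *)
Lemma pnorm_bounds : exists2 c, 0 < c & forall u v,
  dotv u u <= c * pnorm u v /\ dotv v v <= c * pnorm u v.
Proof.
pose c1 := m^-1; pose c2 := 2 * sigma + 2 * sigma ^+ 2 * kappa * m^-1.
have c10 : 0 < c1 by rewrite invr_gt0.
have c20 : 0 < c2.
  by rewrite ltr_pwDl// ?mulr_gt0// !mulr_ge0// ?sqr_ge0// ltW.
exists (c1 + c2); first exact: addr_gt0.
move=> u v; have N0 := pnorm_ge0 u v; have Ng := pnorm_ge u v.
have u0 : dotv u u <= c1 * pnorm u v by rewrite ler_pdivlMl// pnorm_ge_m.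
have v0 : dotv v v <= c2 * pnorm u v.
  have := dotv_sqrD (v - sigma *: (B *m u)) (sigma *: (B *m u)); rewrite subrK.
  move: Ng; set w := dotv (v - _) _ => Ng.
  have w0 : 0 <= w := dotv_ge0 _.
  have {Ng} : w <= sigma * pnorm u v.
    rewrite -ler_pdivrMl//; apply: le_trans Ng; rewrite lerDr.
    by rewrite mulr_ge0 ?dotv_ge0// ltW.
  have : sigma ^+ 2 * dotv (B *m u) (B *m u) <= sigma ^+ 2 * (kappa * (c1 * pnorm u v)).
    rewrite ler_wpM2l ?sqr_ge0//; apply: le_trans (B_kappa u) _.
    by rewrite ler_wpM2l.
  by rewrite dotvZl dotvZr /c2 /c1 expr2; lra.
by split; [apply: le_trans u0 _ | apply: le_trans v0 _];
  rewrite ler_wpM2r// ?lerDl ?lerDr ltW.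
Qed.

Lemma pnorm_ub : exists2 c, 0 < c & forall u v,
  pnorm u v <= c * (dotv u u + dotv v v).
Proof.
exists (tau^-1 + 1 + kappa + sigma^-1).
  by rewrite !ltr_pwDr ?invr_gt0// ?ltr_wpDl// ?addr_ge0// ltW// invr_gt0.
move=> u v; have := dotv_ge0 (B *m u + v); have := B_kappa u.
rewrite !dotvE (dotvC v) /pnorm.
have h1 : 0 <= kappa * dotv v v by rewrite mulr_ge0 ?dotv_ge0.
have h2 : 0 <= tau^-1 * dotv v v by rewrite mulr_ge0 ?dotv_ge0// invr_ge0 ltW.
have h3 : 0 <= sigma^-1 * dotv u u by rewrite mulr_ge0 ?dotv_ge0// invr_ge0 ltW.
have := dotv_ge0 u; have := dotv_ge0 v; lra.
Qed.

(** * The Lagrangian and summability of the dual residuals *)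

Let e k := tau^-1 *: a k + (g (X k) - g (x k)).

Let E := 2 * tau^-1 ^+ 2 + 2 * lambda^-1 ^+ 2.

Lemma primal_error_le k : dotv (e k) (e k) <= E * dotv (a k) (a k).
Proof.
have := dotv_sqrD (tau^-1 *: a k) (g (X k) - g (x k)); rewrite -/(e k).
have := grad_lipschitz (x k) (X k).
have -> : dotv (X k - x k) (X k - x k) = dotv (a k) (a k).
  by rewrite /a -opprB dotvNl dotvNr opprK.
by rewrite dotvZl dotvZr /E; set t := tau^-1; set l := lambda^-1; lra.
Qed.

(** [e k] is the error of reading the optimality condition at [X k] instead of [x k]:
    [e k - g (X k) - B^T y_k] is normal to [C] at [X k]. Strong convexity of [F] does the rest. *)
Lemma primal_step_le k c : C c ->
  F (X k) + dotv (B *m X k) (y k) + dotv (e k) (c - X k)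
    + mu / 2 * dotv (c - X k) (c - X k) <= F c + dotv (B *m c) (y k).
Proof.
move=> Cc; have := XP k Cc; have := smooth_strongly_convex (X k) c.
have h : dotv (B^T *m y k) (c - X k) = dotv (B *m c) (y k) - dotv (B *m X k) (y k).
  by rewrite dotv_trmxl mulmxBr dotvC dotvDl dotvNl.
rewrite /e; move: (g (X k)) (g (x k)) (a k) (c - X k) h => g1 g2 u w h.
by rewrite !dotvDl !dotvNl dotvZl h; lra.
Qed.

(* Value of the Lagrangian, in which [phi^* (Y k)] is [dotv (q k) (Y k) - f (q k)]. *)
Let U k := F (X k.+1) + dotv (B *m X k.+1 - q k) (Y k) + f (q k).

Let y_Y k : y k.+1 = Y k + (1 - rho) *: b k.
Proof. by rewrite yS /b; apply/matrixP => i j; rewrite !mxE; ring. Qed.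

(** Primal optimality at index [k.+1] is tested with [X k.+2], and the subgradient [Y k] with
    [q k.+1]. The ascent comes from pairing the [- b / sigma] in [B X - q] with the [- b] in the
    increment of [Y]. *)
Lemma lagrangian_step k :
  dotv (e k.+1) (X k.+2 - X k.+1)
  + sigma^-1 * (dotv (b k.+1) (b k.+1) - (1 - rho) * dotv (b k.+1) (b k))
  - dotv (B *m (X k.+2 - X k.+1 + a k.+1)) (b k.+1)
  + (1 - rho) * dotv (B *m a k.+1) (b k) <= U k.+1 - U k.
Proof.
have := primal_step_le k.+1 (XC k.+2); have := (YP k).2 _ (YP k.+1).1.
have : 0 <= mu / 2 * dotv (X k.+2 - X k.+1) (X k.+2 - X k.+1).
  by rewrite mulr_ge0 ?dotv_ge0// divr_ge0// ltW.
have Y1 : Y k.+1 = Y k + (1 - rho) *: b k - b k.+1.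
  by rewrite -y_Y {1}/b opprB addrC subrK.
rewrite /U (qE k.+1) Y1 y_Y (mulmxDr B (X k.+2 - _)) (mulmxBr B (X k.+2)).
move: (mu / 2 * _) (dotv (e _) _) (b k.+1) (b k) (a k.+1) => M ed b1 b0 a1.
move: (B *m X k.+2) (B *m X k.+1) (B *m a1) (Y k) (q k) => u2 u1 ba Yk q0.
by rewrite !dotvE !(dotvC Yk); lra.
Qed.

Let w := rho / sigma.

Let w_gt0 : 0 < w. Proof. exact: divr_gt0. Qed.

(** Young on the products with the previous dual residual costs this multiple of its square. Put
    into the potential [U k - beta0 |b k|^2] it telescopes, and [3 / 4 * w] of the ascent
    remains. *)
Let beta0 := (1 - rho) / (2 * sigma) + w / 8.

Let K1 := E / 2 + 1 + 14 * kappa / w.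

Lemma lagrangian_increase k :
  3 / 4 * w * dotv (b k.+1) (b k.+1)
  - K1 * (dotv (a k.+1) (a k.+1) + dotv (a k.+2) (a k.+2)) <=
  U k.+1 - beta0 * dotv (b k.+1) (b k.+1) - (U k - beta0 * dotv (b k) (b k)).
Proof.
have := lagrangian_step k; have := primal_error_le k.+1.
have XE : X k.+2 - X k.+1 = (1 - rho) *: a k.+1 - a k.+2.
  by rewrite /a (xS k.+1) /a; apply/matrixP => i j; rewrite !mxE; ring.
move: (X k.+2 - X k.+1) (e k.+1) (b k.+1) (b k) (a k.+1) (a k.+2) XE
  => dX ek b1 b0 a1 a2 XE hE hU.
have h2 : 0 < 2^-1 :> R by rewrite invr_gt0.
have r1 : 0 <= 1 - rho by rewrite subr_ge0.
(* This weight charges only [w / 8] to a dual square and the rest to primal residuals, which are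
   summable. *)
have tw : 0 < 2 / w by rewrite divr_gt0.
have a10 := dotv_ge0 a1; have a20 := dotv_ge0 a2.
have dX_le : dotv dX dX <= 2 * dotv a1 a1 + 2 * dotv a2 a2.
  rewrite XE; apply: le_trans (dotv_sqrB _ _) _; rewrite lerD2r dotvZl dotvZr.
  rewrite ler_pM2l// mulrA ler_piMl// -expr2 expr_le1//.
  by rewrite gerBl ltW.
have BdX : dotv (B *m (dX + a1)) (B *m (dX + a1)) <=
    kappa * (6 * dotv a1 a1 + 4 * dotv a2 a2).
  apply: le_trans (B_kappa _) _; rewrite ler_wpM2l//.
  by have := dotv_sqrD dX a1; lra.
have Ba1 := B_kappa a1.
have Y1 : dotv (- ek) dX <= 2^-1 * (E * dotv a1 a1) + (dotv a1 a1 + dotv a2 a2).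
  have := dotv_young (- ek) dX h2; rewrite !dotvNl !dotvNr.
  by rewrite (_ : (4 * 2^-1)^-1 = 2^-1); [lra|field].
have w8 : (4 * (2 / w))^-1 = w / 8 by field; exact: lt0r_neq0.
have Y2 : dotv (B *m (dX + a1)) b1 <=
    2 / w * (kappa * (6 * dotv a1 a1 + 4 * dotv a2 a2)) + w / 8 * dotv b1 b1.
  apply: le_trans (dotv_young _ _ tw) _; rewrite w8 lerD2r.
  by rewrite ler_pM2l.
have Y3 : (1 - rho) * dotv (- (B *m a1)) b0 <=
    2 / w * (kappa * dotv a1 a1) + w / 8 * dotv b0 b0.
  have : dotv (- (B *m a1)) b0 <= 2 / w * (kappa * dotv a1 a1) + w / 8 * dotv b0 b0.
    apply: le_trans (dotv_young _ _ tw) _; rewrite w8 lerD2r.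
    by rewrite dotvNl dotvNr opprK ler_pM2l.
  move=> /(ler_wpM2l r1) h; apply: le_trans h _.
  apply: ler_piMl; last by rewrite gerBl ltW.
  apply: addr_ge0.
    by rewrite !mulr_ge0// ltW// invr_gt0.
  by rewrite mulr_ge0 ?dotv_ge0// divr_ge0// ltW.
have Y4 : (1 - rho) / sigma * dotv b1 b0 <=
    (1 - rho) / sigma * (2^-1 * dotv b1 b1 + 2^-1 * dotv b0 b0).
  have := dotv_young b1 b0 h2; rewrite (_ : (4 * 2^-1)^-1 = 2^-1); last by field.
  by apply: ler_wpM2l; rewrite divr_ge0// ltW.
have wE : w = rho * sigma^-1 by [].
have bE : beta0 = (1 - rho) * sigma^-1 / 2 + w / 8.
  by rewrite /beta0; field; rewrite !lt0r_neq0.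
have k2 : 0 <= 2 / w * kappa by rewrite mulr_ge0// ltW.
have k2a : 0 <= 2 / w * kappa * dotv a2 a2 by rewrite mulr_ge0.
have KE : K1 = E / 2 + 1 + 7 * (2 / w * kappa) by rewrite /K1; field; rewrite !lt0r_neq0.
have E0 : 0 <= E * dotv a2 a2.
  by rewrite mulr_ge0// addr_ge0// mulr_ge0// sqr_ge0.
move: hU Y1 Y2 Y3 Y4; rewrite !dotvNl bE KE wE.
set u1 := U k.+1; set u0 := U k; move: k2a E0; set cw := 2 / w.
move: (dotv (B *m a1) b0) (dotv (B *m _) b1) (dotv b1 b0) => d1 d2 d3.
move: (dotv b0 b0) (dotv b1 b1) (dotv a2 a2) (dotv a1 a1) a10 a20 => d4 d5 d6 d7 a10 a20.
move: (dotv ek _) (E) (sigma^-1) cw u1 u0 => d8 E' si cw u1 u0.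
lra.
Qed.

(** A feasible point suffices for an upper bound: the subgradient inequality at [B c] removes the
    conjugate, and strong convexity of [F] absorbs the errors, which are linear in [c - X k.+1]. *)
Lemma lagrangian_le k c : C c -> D (B *m c) ->
  U k <= F c + f (B *m c) + (2 * mu)^-1 *
    dotv ((1 - rho) *: (B^T *m b k) - e k.+1) ((1 - rho) *: (B^T *m b k) - e k.+1).
Proof.
move=> Cc Dc; have := primal_step_le k.+1 Cc; have := (YP k).2 _ Dc.
have t0 : 0 < (2 * mu)^-1 by rewrite invr_gt0 mulr_gt0.
have := dotv_young ((1 - rho) *: (B^T *m b k) - e k.+1) (c - X k.+1) t0.
have -> : (4 * (2 * mu)^-1)^-1 = mu / 2 by field; exact: lt0r_neq0.
have h : dotv (B^T *m b k) (c - X k.+1) = dotv (B *m c) (b k) - dotv (B *m X k.+1) (b k).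
  by rewrite dotv_trmxl mulmxBr dotvC dotvDl dotvNl.
rewrite /U y_Y.
set W := dotv (_ *: _ - _) (_ *: _ - _); set V := dotv (c - _) (c - _).
have -> : dotv ((1 - rho) *: (B^T *m b k) - e k.+1) (c - X k.+1) =
   (1 - rho) * (dotv (B *m c) (b k) - dotv (B *m X k.+1) (b k))
   - dotv (e k.+1) (c - X k.+1).
  by rewrite dotvDl dotvNl dotvZl h.
rewrite (dotvDr (Y k)) (dotvDr (Y k)) !dotvZr (dotvDl (B *m X k.+1)) dotvNl.
rewrite (dotvDr (B *m c)) dotvNr (dotvC (Y k) (B *m c)) (dotvC (Y k) (q k)).
lra.
Qed.

(** The residuals are bounded in the preconditioner norm, so the potential of [lagrangian_increase]
    is bounded above, and its increments telescope. *)
Lemma sum_dual_residual_le c : C c -> D (B *m c) ->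
  exists S, forall K, \sum_(0 <= j < K) dotv (b j) (b j) <= S.
Proof.
move=> Cc Dc; have [c0 c00 hc0] := pnorm_bounds.
set N0 := pnorm (a 0%N) (b 0%N).
have abnd k : dotv (a k) (a k) <= c0 * N0.
  by apply: le_trans (hc0 (a k) (b k)).1 _; rewrite ler_pM2l// pnorm_le0.
have bbnd k : dotv (b k) (b k) <= c0 * N0.
  by apply: le_trans (hc0 (a k) (b k)).2 _; rewrite ler_pM2l// pnorm_le0.
have E0 : 0 <= E by rewrite addr_ge0// mulr_ge0// sqr_ge0.
pose M := F c + f (B *m c) + (2 * mu)^-1 * (2 * (kappa * (c0 * N0)) + 2 * (E * (c0 * N0))).
have UM k : U k - beta0 * dotv (b k) (b k) <= M.
  have b0 : 0 <= beta0 * dotv (b k) (b k).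
    rewrite mulr_ge0 ?dotv_ge0// addr_ge0// divr_ge0 ?subr_ge0//; last exact: ltW.
    by rewrite mulr_ge0// ltW.
  have : U k <= M; last lra.
  apply: le_trans (lagrangian_le k Cc Dc) _; rewrite lerD2l ler_pM2l ?invr_gt0 ?mulr_gt0//.
  apply: le_trans (dotv_sqrB _ _) _; rewrite lerD// ler_pM2l//.
    rewrite dotvZl dotvZr mulrA; apply: le_trans (ler_piMl _ _) _.
    - exact: dotv_ge0.
    - by rewrite -expr2 expr_le1// ?subr_ge0// gerBl ltW.
    - by apply: le_trans (dotv_trmx kappa_ge0 B_kappa _) _; rewrite ler_wpM2l.
  by apply: le_trans (primal_error_le _) _; rewrite ler_wpM2l.
have K10 : 0 <= K1.
  by rewrite addr_ge0 ?divr_ge0 ?mulr_ge0 ?addr_ge0 ?divr_ge0// ltW.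
have tel K := telescope_le K lagrangian_increase UM.
set u0 := U 0%N - _ in tel.
pose Sa := N0 / (2 * theta * mu * rho).
have Sa1 K : \sum_(0 <= j < K) dotv (a j.+1) (a j.+1) <= Sa.
  apply: le_trans (sum_primal_residual_le K.+1); rewrite big_nat_recl// lerDr.
  exact: dotv_ge0.
have Sa2 K : \sum_(0 <= j < K) dotv (a j.+2) (a j.+2) <= Sa.
  by apply: le_trans (Sa1 K.+1); rewrite big_nat_recl// lerDr dotv_ge0.
(* The telescoped sum starts at index 1, so the residual of index 0 is added separately. *)
exists (dotv (b 0%N) (b 0%N) + (M - u0 + K1 * (2 * Sa)) / (3 / 4 * w)) => K.
apply: (@le_trans _ _ (\sum_(0 <= j < K.+1) dotv (b j) (b j))).
  by rewrite big_nat_recr//= lerDl dotv_ge0.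
have w34 : 0 < 3 / 4 * w by rewrite mulr_gt0// divr_gt0.
rewrite big_nat_recl// lerD2l ler_pdivlMr//.
have := tel K; rewrite sumrB -!mulr_sumr big_split/=.
have := ler_wpM2l K10 (lerD (Sa1 K) (Sa2 K)); lra.
Qed.

(** * The primal gap and convergence of the iterates *)

Let eps k := mu^-1 * dotv (e k - B^T *m b k) (e k - B^T *m b k)
  + dotv (q k - B *m X k) (Y k).

(** Substitute [y k = Y k + b k] in [primal_step_le] and add the subgradient inequality at [B c].
    Half of the strong convexity absorbs [e k - B^T b_k]; the other part of [eps k] pairs the
    residual [q k - B X_k] with the possibly unbounded [Y k]. *)
Lemma primal_gap_le k c : C c -> D (B *m c) ->
  F (X k) + f (q k) + mu / 4 * dotv (c - X k) (c - X k) <= F c + f (B *m c) + eps k.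
Proof.
move=> Cc Dc; have := primal_step_le k Cc; have := (YP k).2 _ Dc.
have t0 : 0 < mu^-1 by rewrite invr_gt0.
have := dotv_young (- (e k - B^T *m b k)) (c - X k) t0.
have -> : (4 * mu^-1)^-1 = mu / 4 by field; exact: lt0r_neq0.
have h : dotv (B^T *m b k) (c - X k) = dotv (B *m c) (b k) - dotv (B *m X k) (b k).
  by rewrite dotv_trmxl mulmxBr dotvC dotvDl dotvNl.
have yE : y k = Y k + b k by rewrite /b addrC subrK.
rewrite /eps dotvNl !(dotvNl _ (- _)) (dotvNr (e k - _)) opprK.
rewrite (dotvDl (e k) _ (c - X k)) (dotvNl _ (c - X k)) h yE.
rewrite (dotvDr (Y k) (b k) (B *m c)) (dotvDr (Y k) (b k) (B *m X k)).
rewrite (dotvDl (q k)) (dotvNl (B *m X k)) (dotvDr (B *m c)) (dotvNr (q k)).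
rewrite (dotvC (Y k) (B *m c)) (dotvC (Y k) (q k)).
set W := dotv (_ - _) (_ - _); set V := dotv (c - _) (c - _).
lra.
Qed.

(** The squared residual norms are nonincreasing and summable, hence [o(1/k)], while [|Y k|^2] is
    [O(k)]. Young with weight [t (k+1)] bounds the product in [eps k] by a vanishing term plus
    [M3 / (4 t)], with [t] free. *)
Lemma residual_cvg c : C c -> D (B *m c) ->
  (exists S, forall k, eps k <= S) /\
  (forall r, 0 < r -> exists K, forall k, (K <= k)%N ->
     [/\ eps k < r, dotv (q k - B *m X k) (q k - B *m X k) < r &
         dotv (a k) (a k) < r]).
Proof.
move=> Cc Dc; have [Sb hSb] := sum_dual_residual_le Cc Dc.
have [c0 c00 hc0] := pnorm_bounds; have [c1 c10 hc1] := pnorm_ub.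
pose N k := pnorm (a k) (b k).
pose T k := k.+1%:R * N k.
have N0 k : 0 <= N k := pnorm_ge0 _ _.
pose Sa := N 0%N / (2 * theta * mu * rho).
have NS k : N k.+1 <= N k.
  by apply: le_trans (pnorm_decrease k) _; rewrite gerBl !mulr_ge0 ?dotv_ge0 ?ltW.
have SN K : \sum_(0 <= j < K) N j <= c1 * (Sa + Sb).
  apply: (@le_trans _ _ (\sum_(0 <= j < K) c1 * (dotv (a j) (a j) + dotv (b j) (b j)))).
    by apply: ler_sum => j _; exact: hc1.
  by rewrite -mulr_sumr ler_pM2l// big_split/= lerD// sum_primal_residual_le.
have [TS Tcvg] := nonincreasing_summable N0 NS SN.
have NT k : N k <= T k by rewrite ler_peMl// ler1n.
have T0 k : 0 <= T k by rewrite mulr_ge0.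
have E0 : 0 <= E by rewrite addr_ge0// mulr_ge0// sqr_ge0.
have aN k : dotv (a k) (a k) <= c0 * N k := (hc0 _ _).1.
have bN k : dotv (b k) (b k) <= c0 * N k := (hc0 _ _).2.
pose M1 := mu^-1 * (2 * (E * c0) + 2 * (kappa * c0)).
have M10 : 0 <= M1.
  have c0' := ltW c00; apply: mulr_ge0; first by rewrite invr_ge0 ltW.
  by apply: addr_ge0; rewrite mulr_ge0// mulr_ge0.
have h1 k : mu^-1 * dotv (e k - B^T *m b k) (e k - B^T *m b k) <= M1 * N k.
  rewrite /M1 -mulrA ler_pM2l ?invr_gt0//; apply: le_trans (dotv_sqrB _ _) _.
  have := le_trans (primal_error_le k) (ler_wpM2l E0 (aN k)).
  have := le_trans (dotv_trmx kappa_ge0 B_kappa (b k)) (ler_wpM2l kappa_ge0 (bN k)).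
  lra.
pose M2 := 2 * (sigma^-1 ^+ 2 * c0) + 2 * (kappa * c0).
have M20 : 0 <= M2.
  have sg := sqr_ge0 sigma^-1; have c0' := ltW c00.
  by apply: addr_ge0; rewrite mulr_ge0// mulr_ge0.
have h2 k : dotv (q k - B *m X k) (q k - B *m X k) <= M2 * N k.
  have -> : q k - B *m X k = sigma^-1 *: b k - B *m a k.
    by rewrite qE; move: (B *m a k) => u; rewrite [LHS]addrAC addrK.
  apply: le_trans (dotv_sqrB _ _) _; rewrite dotvZl dotvZr.
  have := ler_wpM2l (sqr_ge0 sigma^-1) (bN k).
  have := le_trans (B_kappa (a k)) (ler_wpM2l kappa_ge0 (aN k)).
  rewrite /M2; set si := sigma^-1; lra.
(* By [dotv_sum_le] the accumulated dual residuals contribute [O(k Sb)] to [|y k|^2]; the added 1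
   makes the constant positive. *)
pose M3 := 4 * dotv (y 0%N) (y 0%N) + 4 * Sb + 1.
have b_Sb k : dotv (b k) (b k) <= Sb.
  apply: le_trans (hSb k.+1); rewrite big_nat_recr//= lerDr.
  by apply: sumr_ge0 => j _; exact: dotv_ge0.
have Sb0 : 0 <= Sb := le_trans (dotv_ge0 _) (b_Sb 0%N).
have M30 : 0 < M3 by have := dotv_ge0 (y 0%N); rewrite /M3; lra.
have h3 k : dotv (Y k) (Y k) <= M3 * k.+1%:R.
  have yE : y k = y 0%N - rho *: \sum_(0 <= j < k) b j.
    elim: k => [|k IH]; first by rewrite big_geq// scaler0 subr0.
    rewrite big_nat_recr//= yS; move: (b k) => bk.
    by rewrite IH scalerDr opprD addrA.
  have YE : Y k = y k - b k by rewrite /b opprB addrC subrK.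
  have hY : dotv (Y k) (Y k) <= 2 * dotv (y k) (y k) + 2 * dotv (b k) (b k).
    by rewrite YE; exact: dotv_sqrB.
  have hy : dotv (y k) (y k) <= 2 * dotv (y 0%N) (y 0%N) + 2 * (k%:R * Sb).
    rewrite yE; apply: le_trans (dotv_sqrB _ _) _; rewrite lerD2l ler_pM2l//.
    rewrite dotvZl dotvZr mulrA; apply: le_trans (ler_piMl (dotv_ge0 _) _) _.
      by rewrite -expr2 expr_le1// ltW.
    by apply: le_trans (dotv_sum_le _ _) _; rewrite ler_wpM2l.
  have k0 : 0 <= k%:R :> R by [].
  have := mulr_ge0 k0 (dotv_ge0 (y 0%N)).
  have := b_Sb k; rewrite /M3 -natr1; lra.
have h t k : 0 < t -> eps k <= (M1 + t * M2) * T k + M3 / (4 * t).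
  move=> t0; have kt : 0 < t * k.+1%:R by rewrite mulr_gt0.
  have := dotv_young (q k - B *m X k) (Y k) kt.
  have : t * k.+1%:R * dotv (q k - B *m X k) (q k - B *m X k) <= t * M2 * T k.
    by rewrite /T mulrACA ler_pM2l.
  have : (4 * (t * k.+1%:R))^-1 * dotv (Y k) (Y k) <= M3 / (4 * t).
    rewrite ler_pdivrMl ?mulr_gt0//; apply: le_trans (h3 k) _.
    rewrite le_eqVlt; apply/orP; left; apply/eqP; field.
    exact: lt0r_neq0.
  have := ler_wpM2l M10 (NT k); have := h1 k; rewrite /eps.
  move: (mu^-1 * _) ((4 * _)^-1 * _) (t * k.+1%:R * _) => u1 u2 u3; lra.
split.
  exists ((M1 + 1 * M2) * (c1 * (Sa + Sb)) + M3 / (4 * 1)) => k.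
  apply: le_trans (h 1 k ltr01) _; rewrite lerD2r ler_wpM2l ?addr_ge0 ?mul1r//.
  exact: TS.
(* The choice of [t] turns [M3 / (4 t)] into [r / 2]. *)
move=> r r0; pose t := M3 / (2 * r).
have t0 : 0 < t by rewrite divr_gt0// mulr_gt0.
pose M := M1 + t * M2 + M2 + c0 + 1.
have tM2 : 0 <= t * M2 by rewrite mulr_ge0// ltW.
have M0 : 0 < M by rewrite /M; lra.
have rM : 0 < r / 2 / M by rewrite !divr_gt0.
have [K hK] := Tcvg _ rM; exists K => k /hK; rewrite -/(T k) ltr_pdivlMr// => TM.
have := T0 k => Tk0.
have p1 : 0 <= M1 * T k by rewrite mulr_ge0.
have p2 : 0 <= t * M2 * T k by rewrite mulr_ge0.
have p3 : 0 <= M2 * T k by rewrite mulr_ge0.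
have p4 : 0 <= c0 * T k by rewrite mulr_ge0// ltW.
split.
- apply: le_lt_trans (h t k t0) _.
  have -> : M3 / (4 * t) = r / 2 by rewrite /t; field; rewrite !lt0r_neq0.
  rewrite /M in TM; lra.
- apply: le_lt_trans (h2 k) _; have := ler_wpM2l M20 (NT k); rewrite /M in TM; lra.
- apply: le_lt_trans (aN k) _; have := ler_wpM2l (ltW c00) (NT k); rewrite /M in TM; lra.
Qed.

Lemma splitting_cvg c : C c -> D (B *m c) ->
  exists xs, [/\ C xs, D (B *m xs),
    forall u, C u -> D (B *m u) -> F xs + f (B *m xs) <= F u + f (B *m u) &
    x @ \oo --> xs].
Proof.
move=> Cc Dc; have [[S epsS] res] := residual_cvg Cc Dc.
have [M XM] : exists M, forall k, dotv (X k) (X k) <= M.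
  (* The gap inequality at [c] meets the strongly convex lower bound of [F] at [c] and [f >= 0];
     after Young on [g c], [mu / 2] of the quadratic terms survives. *)
  pose M := mu^-1 * (2 * (f (B *m c) + S + mu^-1 * dotv (g c) (g c))).
  exists (2 * M + 2 * dotv c c) => k.
  have hX : dotv (X k - c) (X k - c) <= M.
    rewrite ler_pdivlMl//.
    have := primal_gap_le k Cc Dc; have := smooth_strongly_convex c (X k); have := epsS k.
    have := cc_ge0 D_cc (YP k).1.
    have t0 : 0 < mu^-1 by rewrite invr_gt0.
    have := dotv_young (- g c) (X k - c) t0.
    have -> : (4 * mu^-1)^-1 = mu / 4 by field; exact: lt0r_neq0.
    have -> : dotv (c - X k) (c - X k) = dotv (X k - c) (X k - c).
      by rewrite -opprB dotvNl dotvNr opprK.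
    rewrite !(dotvNl (g c)) (dotvNr (g c)) opprK; lra.
  have := dotv_sqrD (X k - c) c; rewrite subrK; lra.
(* [F l] is compared with [F (X k)] by linearization at [l], and [f] at [B l] is reached through the
   nearby points [q k] and the closed epigraph. The term in [u - l] is kept for uniqueness. *)
have cl l : cluster_pt X l -> [/\ C l, D (B *m l) &
    forall u, C u -> D (B *m u) ->
      f (B *m l) <= F u + f (B *m u) - F l - mu / 4 * dotv (u - l) (u - l)].
  move=> Xl.
  have Cl : C l.
    have [] // := @cc_closed _ _ _ _ C_cc l 0 _ => r r0.
    by have [k _ hk] := Xl r 0%N r0; exists (X k).
  have key u r : C u -> D (B *m u) -> 0 < r -> D (B *m l) /\
      f (B *m l) <= F u + f (B *m u) - F l - mu / 4 * dotv (u - l) (u - l) + r.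
    move=> Cu Du r0; apply: (cc_closed D_cc) => r' r'0.
    pose r1 := r / mu.
    have r10 : 0 < r1 by rewrite divr_gt0.
    have [d1 d10 hd1] := dotv_near u l r10.
    pose t := r / (4 * (dotv (g l) (g l) + 1)).
    have gl0 := dotv_ge0 (g l).
    have t0 : 0 < t by rewrite divr_gt0// mulr_gt0// ltr_wpDl.
    have tg : t * dotv (g l) (g l) <= r / 4.
      rewrite /t mulrAC ler_pdivrMr; last by rewrite mulr_gt0// ltr_wpDl.
      have := mulr_ge0 (ltW r0) gl0; lra.
    pose d2 := r * t; have d20 : 0 < d2 by rewrite mulr_gt0.
    pose d3 := r' / (4 * (kappa + 1)).
    have d30 : 0 < d3 by rewrite divr_gt0// mulr_gt0// ltr_wpDl.
    pose r2 := Num.min (r / 4) (r' / 4).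
    have r20 : 0 < r2 by rewrite lt_min !divr_gt0.
    have [K hK] := res r2 r20.
    pose dd := Num.min d1 (Num.min d2 d3).
    have dd0 : 0 < dd by rewrite !lt_min d10 d20.
    have [k Kk] := Xl dd K dd0; rewrite !lt_min => /and3P[k1 k2 k3].
    have [] := hK k Kk; rewrite !lt_min => /andP[e1 _] /andP[_ q2] _.
    exists (q k); split; first exact: (YP k).1.
      have -> : q k - B *m l = (q k - B *m X k) + B *m (X k - l).
        by rewrite mulmxBr addrA subrK.
      apply: le_lt_trans (dotv_sqrD _ _) _.
      have hk : kappa * dotv (X k - l) (X k - l) <= r' / 4.
        apply: (@le_trans _ _ (kappa * d3)); first by rewrite ler_wpM2l// ltW.
        rewrite /d3 mulrCA ler_pM2l// ler_pdivrMr ?mulr_gt0// ?ltr_wpDl//.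
        lra.
      have := B_kappa (X k - l); lra.
    have h1 := primal_gap_le k Cu Du; have h2 := smooth_strongly_convex l (X k).
    have {hd1} := hd1 _ k1.
    have -> : dotv (X k - u) (X k - u) = dotv (u - X k) (u - X k).
      by rewrite -opprB dotvNl dotvNr opprK.
    have -> : dotv (l - u) (l - u) = dotv (u - l) (u - l).
      by rewrite -opprB dotvNl dotvNr opprK.
    rewrite -(ler_pM2l mu_gt0) => h3.
    have r1E : mu * r1 = r by rewrite /r1 mulrCA divff ?mulr1// lt0r_neq0.
    have : (4 * t)^-1 * dotv (X k - l) (X k - l) <= r / 4.
      have t4 : 0 < 4 * t by rewrite (mulr_gt0 _ t0).
      rewrite ler_pdivrMl//; apply: le_trans (ltW k2) _.
      by rewrite /d2; move: (t) => t'; lra.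
    have := dotv_young (- g l) (X k - l) t0.
    rewrite !(dotvNl (g l)) (dotvNr (g l)) opprK => h4 h5.
    have h6 : 0 <= mu / 2 * dotv (X k - l) (X k - l).
      by rewrite mulr_ge0 ?dotv_ge0// divr_ge0// ltW.
    move: h3; rewrite mulrDr r1E => h3; lra.
  split => //; first by case: (key c 1 Cc Dc ltr01).
  by move=> u Cu Du; apply/ler_addgt0Pr => r r0; case: (key u r Cu Du r0).
have [xs Xxs] := bounded_cluster_pt XM.
have [Cxs Dxs mxs] := cl _ Xxs.
exists xs; split => //.
  move=> u Cu Du; have := mxs u Cu Du.
  have : 0 <= mu / 4 * dotv (u - xs) (u - xs).
    by rewrite mulr_ge0 ?dotv_ge0// divr_ge0// ltW.
  lra.
have Xcvg := cvg_unique_cluster_pt XM (_ : forall l, cluster_pt X l -> l = xs).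
apply: cvg_dotv => r r0.
have r4 : 0 < r / 4 by rewrite divr_gt0.
have [|K1' hK1] := Xcvg _ (r / 4) r4.
  (* Two cluster points are tested against each other; adding both inequalities forces their
     distance to vanish. *)
  move=> l /cl[Cl Dl ml]; apply/eqP; rewrite -subr_eq0; apply/eqP/dotv_eq0.
  have := mxs _ Cl Dl; have := ml _ Cxs Dxs.
  have -> : dotv (xs - l) (xs - l) = dotv (l - xs) (l - xs).
    by rewrite -opprB dotvNl dotvNr opprK.
  move=> h1 h2; rewrite -(pmulr_rle0 _ mu_gt0); lra.
have [K2 hK2] := res _ r4.
exists (maxn K1' K2) => k; rewrite geq_max => /andP[/hK1 k1 /hK2[_ _ k2]].
have -> : x k - xs = a k + (X k - xs) by rewrite /a addrA subrK.
apply: le_lt_trans (dotv_sqrD _ _) _; lra.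
Qed.

End PrimalDualSplitting.

(** * The iteration of the theorem as an instance of the splitting *)

Theorem theorem1 (R : realType) (d n : nat)
    (C : set 'cV[R]_d) (z : 'cV[R]_d) (B : 'M[R]_(n, d))
    (phi : 'cV[R]_n -> \bar R) (lambda alpha tau sigma rho : R)
    (x xt : nat -> 'cV[R]_d) (y yt : nat -> 'cV[R]_n)
    (C_neq0 : C !=set0) (C_closed : closed C) (C_convex : convex_set C)
    (phi_SPF : SPF phi) (phi_convex : econvex phi)
    (* problem (P) is feasible: its objective is proper on C *)
    (P_proper : exists2 u, C u & (objective z B phi lambda alpha u < +oo)%E)
    (lambda_gt0 : 0 < lambda) (alpha_gt0 : 0 < alpha)
    (tau_gt0 : 0 < tau) (sigma_gt0 : 0 < sigma)
    (xtE : forall k, xt k.+1 =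
       proj C (x k - (tau / lambda) *: (x k - z)
               + tau *: (B^T *m (prox alpha^-1 (fconj phi)
                                   (alpha^-1 *: (B *m x k)) - y k))))
    (ytE : forall k, yt k.+1 =
       prox sigma (fconj phi)
         (y k + sigma *: (B *m (2 *: xt k.+1 - x k))))
    (xE : forall k, x k.+1 = rho *: xt k.+1 + (1 - rho) *: x k)
    (yE : forall k, y k.+1 = rho *: yt k.+1 + (1 - rho) *: y k)
    (lambda_lt : B != 0 -> lambda < alpha / spectral_norm B ^+ 2)
    (cond_i : tau^-1 - sigma * spectral_norm B ^+ 2 > (2 * lambda)^-1)
    (cond_ii : 0 < rho <= 1) :
  exists2 xs, argmin C (objective z B phi lambda alpha) xs & x @ \oo --> xs.
Proof.
have [rho_gt0 rho_le1] := andP cond_ii.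
have C_cc := closed_convex_set C_neq0 C_closed C_convex.
have D_cc := SPF_closed_convex phi_SPF phi_convex.
set D := [set u | (phi u < +oo)%E] in D_cc; pose f u := fine (phi u).
have fK := SPF_fineK phi_SPF; have domPn := @domPn_pinfty _ _ phi.
(* For [B = 0] the bound on [lambda] is void and [kappa] is 0; otherwise it is the squared spectral
   norm. *)
have [kappa [kappa_ge0 B_kappa kappa_lt kappa_i]] : exists kappa : R,
    [/\ 0 <= kappa, forall v, dotv (B *m v) (B *m v) <= kappa * dotv v v,
        lambda * kappa < alpha & (2 * lambda)^-1 < tau^-1 - sigma * kappa].
  have [B0|B0] := eqVneq B 0.
    exists 0; split => //; last 1 first.
    - apply: lt_le_trans cond_i _; rewrite mulr0 lerD2l lerN2.
      by rewrite mulr_ge0 ?sqr_ge0// ltW.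
    - by move=> v; rewrite B0 !mul0mx -[0 : 'cV_n](scale0r 0) dotvZl !mul0r.
    - by rewrite mulr0.
  exists (spectral_norm B ^+ 2); split => //.
  - exact: sqr_ge0.
  - exact: spectral_norm_le.
  - have := lambda_lt B0; have := sqr_ge0 (spectral_norm B).
    rewrite le_eqVlt => /predU1P[<-|S0]; first by rewrite invr0 !mulr0.
    by rewrite ltr_pdivlMr.
have /choice[p pP] : forall u, exists p, subgrad D f p (alpha^-1 *: (u - p)).
  by move=> u; exact: prox_exists.
have objE u : D (B *m u) -> objective z B phi lambda alpha u =
    ((2 * lambda)^-1 * dotv (u - z) (u - z)
     - (f (p (B *m u)) + (2 * alpha)^-1 *
          dotv (p (B *m u) - B *m u) (p (B *m u) - B *m u))
     + f (B *m u))%:E.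
  move=> Du; rewrite /objective /env_diff enorm_sqr.
  rewrite (env_subgrad phi_SPF alpha_gt0 (pP (B *m u))) (fK _ Du) -EFinB -EFinD.
  by congr (_%:E); rewrite addrAC addrA.
(* The envelope is finite everywhere, so the objective is infinite where [phi] is. *)
have objPn u : ~ D (B *m u) -> objective z B phi lambda alpha u = +oo%E.
  move=> Du; rewrite /objective /env_diff.
  by rewrite (env_subgrad phi_SPF alpha_gt0 (pP (B *m u))) (domPn _ Du).
have [c Cc Dc] : exists2 c, C c & D (B *m c).
  have [c Cc hc] := P_proper; exists c => //; apply: contrapT => nD.
  by rewrite objPn in hc.
(* Moreau decomposition identifies this proximal step with the gradient of the envelope: [q] and [p]
   solve the same inclusion and agree by monotonicity. *)
have sE k : prox alpha^-1 (fconj phi) (alpha^-1 *: (B *m x k)) =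
    alpha^-1 *: (B *m x k - p (B *m x k)).
  have ia : 0 < alpha^-1 by rewrite invr_gt0.
  have [q hq ->] := prox_fconjP phi_SPF phi_convex (alpha^-1 *: (B *m x k)) ia.
  rewrite -scalerBr in hq *; congr (_ *: (_ - _)).
  have := subgrad_mono hq (pP (B *m x k)).
  rewrite -scalerBr dotvZl pmulr_rge0// => h.
  apply/eqP; rewrite -subr_eq0; apply/eqP/dotv_eq0.
  by move: h; rewrite !dotvE; lra.
have /choice[q qP] : forall k, exists q, subgrad D f q (yt k.+1) /\
    yt k.+1 = y k + sigma *: (B *m (2 *: xt k.+1 - x k)) - sigma *: q.
  move=> k; rewrite ytE.
  have [q hq ->] := prox_fconjP phi_SPF phi_convex
    (y k + sigma *: (B *m (2 *: xt k.+1 - x k))) sigma_gt0.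
  by exists q.
have XP k := projP (x k - (tau / lambda) *: (x k - z)
  + tau *: (B^T *m (prox alpha^-1 (fconj phi) (alpha^-1 *: (B *m x k)) - y k))) C_cc.
(* Index shift: [X k] and [Y k] are the points [xt k.+1] and [yt k.+1] computed from [x k] and
   [y k]. *)
have [|k u Cu|k|k|k|xs [Cxs Dxs xs_min xs_cvg]] := @splitting_cvg R d n C D f z B kappa lambda
  alpha tau sigma rho C_cc D_cc kappa_ge0 lambda_gt0 alpha_gt0 tau_gt0 sigma_gt0 rho_gt0
  rho_le1 B_kappa kappa_lt kappa_i p pP x (fun k => xt k.+1) y (fun k => yt k.+1) q
  _ _ _ (fun k => (qP k).1) _ _ c Cc Dc.
- by move=> k; rewrite xtE; exact: (XP k).1.
- have := (XP k).2 u Cu; rewrite -xtE sE /=.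
  have it : 0 < tau^-1 by rewrite invr_gt0.
  set s := alpha^-1 *: _; rewrite -(pmulr_rle0 _ it) -dotvZl.
  congr (dotv _ _ <= 0); rewrite mulmxBr.
  move: (B^T *m s) (B^T *m y k) => u1 u2.
  by apply/matrixP => i j; rewrite !mxE; field; rewrite !lt0r_neq0.
- have := (qP k).2; move: (q k) => q0 ->; rewrite mulmxBr -!scalemxAr mulmxBr.
  move: (B *m _) (B *m _) => u v.
  by apply/matrixP => i j; rewrite !mxE; field; exact: lt0r_neq0.
- by rewrite xE; apply/matrixP => i j; rewrite !mxE; ring.
- by rewrite yE; apply/matrixP => i j; rewrite !mxE; ring.
exists xs => //; split => // u Cu.
have [Du|nDu] := pselect (D (B *m u)); last by rewrite (objPn _ nDu) leey.
by rewrite !objE// lee_fin; exact: xs_min.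
Qed.
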